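(* Let $d\in\mathbb{N}$ and let $M\geq 2$ be an integer. The worst-case errors in $F_d$ of the quasi-Monte Carlo rules $Q_{S_{M,d}^{\mathrm{comp}}}$, $Q_{T_{M,d}^{\mathrm{comp}}}$ and $Q_{U_{M,d}^{\mathrm{comp}}}$ satisfy $$e^{\mathrm{wor}}(F_d,Q_{S_{M,d}^{\mathrm{comp}}})\leq \frac{8d}{c_{\mathbb{P}}\,|S_{M,d}^{\mathrm{comp}}|^{1/4}},$$ $$e^{\mathrm{wor}}(F_d,Q_{T_{M,d}^{\mathrm{comp}}})\leq \frac{8d}{c_{\mathbb{P}}\,|T_{M,d}^{\mathrm{comp}}|^{1/3}},$$ $$e^{\mathrm{wor}}(F_d,Q_{U_{M,d}^{\mathrm{comp}}})\leq \frac{8d}{c_{\mathbb{P}}\,|U_{M,d}^{\mathrm{comp}}|^{1/3}}.$$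
   Context: $\mathbb{N}$ denotes the positive integers, $\log$ is the natural logarithm, and $\{x\}=x-\lfloor x\rfloor$ is the fractional part of a real number $x\ge 0$. Primes: for an integer $M\geq 2$, $\mathbb{P}_M:=\{p \text{ prime} : \lceil M/2\rceil<p\leq M\}$. By results of Rosser and Schoenfeld there exist absolute constants $0<c_{\mathbb{P}}<1$ and $C_{\mathbb{P}}>1$ such that $c_{\mathbb{P}}\frac{M}{\log M}\leq |\mathbb{P}_M|\leq C_{\mathbb{P}}\frac{M}{\log M}$ for every integer $M\geq 2$; $c_{\mathbb{P}}$ is fixed as such a constant. Function space: for $f\in L^2([0,1)^d)$ (real-valued) and $\boldsymbol{k}\in\mathbb{Z}^d$, let $\hat f(\boldsymbol{k})=\int_{[0,1)^d}f(\boldsymbol{x})\exp(-2\pi i\,\boldsymbol{k}\cdot\boldsymbol{x})\,\mathrm{d}\boldsymbol{x}$ and $\mathrm{supp}(\boldsymbol{k})=\{j\in\{1,\ldots,d\} : k_j\neq 0\}$. Define $$F_d=\Big\{f\in L^2([0,1)^d) : \|f\|:=\sum_{\boldsymbol{k}\in\mathbb{Z}^d}|\hat f(\boldsymbol{k})|\max\Big(1,\min_{j\in\mathrm{supp}(\boldsymbol{k})}\log|k_j|\Big)<\infty\Big\},$$ where for $\boldsymbol{k}=\boldsymbol{0}$ (empty support) the factor $\max(\cdot)$ is taken to be $1$. Since the Fourier series of $f\in F_d$ converges absolutely, $f$ is identified with the (continuous) sum of its Fourier series, so point values $f(\boldsymbol{x})$ are well defined. Worst-case error: with $I_d(f)=\int_{[0,1)^d}f(\boldsymbol{x})\,\mathrm{d}\boldsymbol{x}$,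 for a cubature rule $Q$ set $e^{\mathrm{wor}}(F_d,Q)=\sup_{f\in F_d,\ \|f\|\leq 1}|I_d(f)-Q(f)|$. Point sets (Korobov's $p$-sets): for a prime $p$ let $\boldsymbol{x}_n^{(p)}=(\{n/p\},\{n^2/p\},\ldots,\{n^d/p\})$ for $0\leq n<p$; $\tilde{\boldsymbol{x}}_n^{(p)}=(\{n/p^2\},\{n^2/p^2\},\ldots,\{n^d/p^2\})$ for $0\leq n<p^2$; $\boldsymbol{x}_{k,n}^{(p)}=(\{kn/p\},\{kn^2/p\},\ldots,\{kn^d/p\})$ for $0\leq k,n<p$. $S_{M,d}^{\mathrm{comp}}$, $T_{M,d}^{\mathrm{comp}}$, $U_{M,d}^{\mathrm{comp}}$ are the multiset unions over all $p\in\mathbb{P}_M$ of the respective families of points, with cardinalities counted with multiplicity: $|S_{M,d}^{\mathrm{comp}}|=\sum_{p\in\mathbb{P}_M}p$ and $|T_{M,d}^{\mathrm{comp}}|=|U_{M,d}^{\mathrm{comp}}|=\sum_{p\in\mathbb{P}_M}p^2$. Quasi-Monte Carlo rules: $$Q_{S_{M,d}^{\mathrm{comp}}}(f)=\frac{1}{|S_{M,d}^{\mathrm{comp}}|}\sum_{p\in\mathbb{P}_M}\sum_{n=0}^{p-1}f(\boldsymbol{x}_n^{(p)}),\quad Q_{T_{M,d}^{\mathrm{comp}}}(f)=\frac{1}{|T_{M,d}^{\mathrm{comp}}|}\sum_{p\in\mathbb{P}_M}\sum_{n=0}^{p^2-1}f(\tilde{\boldsymbol{x}}_n^{(p)}),$$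 $$Q_{U_{M,d}^{\mathrm{comp}}}(f)=\frac{1}{|U_{M,d}^{\mathrm{comp}}|}\sum_{p\in\mathbb{P}_M}\sum_{k,n=0}^{p-1}f(\boldsymbol{x}_{k,n}^{(p)}).$$ *)

(* Defs.v *)
From HB Require Import structures.
From mathcomp Require Import all_boot all_order all_algebra.
From mathcomp Require Import complex.
From mathcomp Require Import all_classical all_reals all_analysis.
From mathcomp Require summability.

Set Implicit Arguments.
Unset Strict Implicit.
Unset Printing Implicit Defensive.

Import Order.TTheory GRing.Theory Num.Theory.
Import numFieldNormedType.Exports.

Local Open Scope classical_set_scope.
Local Open Scope ring_scope.
Local Open Scope complex_scope.

Section LebesgueTuple.
Variable R : realType.
Local Notation mR := (measurableTypeR R).

Definition tuple_of_pair (n : nat) (z : mR * n.-tuple mR) : n.+1.-tuple mR :=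
  [tuple of z.1 :: z.2].

Lemma measurable_tuple_of_pair (n : nat) :
  measurable_fun [set: mR * n.-tuple mR] (@tuple_of_pair n).
Proof. exact: (@measurable_cons _ _ _ _ fst n snd). Qed.

Section successor.
Variables (n : nat) (mu : {sigma_finite_measure set (n.-tuple mR) -> \bar R}).

Definition lebesgue_cons : set (n.+1.-tuple mR) -> \bar R :=
  pushforward (@lebesgue_measure R \x mu)%E (@tuple_of_pair n).

Let mpre (A : set (n.+1.-tuple mR)) : measurable A ->
  measurable (@tuple_of_pair n @^-1` A).
Proof.
move=> mA; rewrite -[X in measurable X]setTI.
exact: measurable_tuple_of_pair.
Qed.

Let lebesgue_cons0 : lebesgue_cons set0 = 0%E.
Proof. by rewrite /lebesgue_cons /pushforward preimage_set0 measure0. Qed.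

Let lebesgue_cons_ge0 A : (0 <= lebesgue_cons A)%E.
Proof. by rewrite /lebesgue_cons /pushforward; exact: measure_ge0. Qed.

Let lebesgue_cons_additive : semi_sigma_additive lebesgue_cons.
Proof.
move=> F mF tF mUF; rewrite /lebesgue_cons /pushforward preimage_bigcup.
apply: measure_semi_sigma_additive.
- by move=> k; exact: mpre.
- apply/trivIsetP => /= i j _ _ ij; rewrite -preimage_setI.
  by move/trivIsetP : tF => /(_ _ _ _ _ ij) ->//; rewrite preimage_set0.
- by rewrite -preimage_bigcup; exact: mpre.
Qed.

HB.instance Definition _ := isMeasure.Build _ _ _ lebesgue_cons
  lebesgue_cons0 lebesgue_cons_ge0 lebesgue_cons_additive.

Let lebesgue_cons_sigma_finite : sigma_finite setT lebesgue_cons.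
Proof.
have [F TF Foo] : sigma_finite setT (@lebesgue_measure R \x mu)%E.
  have /sigma_finiteP[F [TF ndF Foo]] := sigma_finiteT (@lebesgue_measure R).
  have /sigma_finiteP[G [TG ndG Goo]] := sigma_finiteT mu.
  exists (fun k => F k `*` G k).
    rewrite -setXTT TF TG predeqE => -[x y]; split; last first.
      by move=> [k _ []/= ? ?]; split; exists k.
    move=> [/= [i _ Fix] [j _ Gjy]]; exists (maxn i j) => //; split.
    - by move: x Fix; exact/subsetPset/ndF/leq_maxl.
    - by move: y Gjy; exact/subsetPset/ndG/leq_maxr.
  move=> k; have [mF Fk] := Foo k; have [mG Gk] := Goo k.
  split; first exact: measurableX.
  by rewrite product_measure1E// lte_mul_pinfty// ge0_fin_numE.
pose g (x : n.+1.-tuple mR) := (thead x, [tuple of behead x]).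
have gK : cancel g (@tuple_of_pair n) by move=> x; rewrite [RHS]tuple_eta.
have fK : cancel (@tuple_of_pair n) g.
  by move=> [x t]; rewrite /g /tuple_of_pair theadE; congr pair; exact: val_inj.
have mg : measurable_fun [set: n.+1.-tuple mR] g.
  apply/measurable_fun_pairP; split; first exact: measurable_tnth.
  exact: measurable_behead.
exists (fun k => g @^-1` F k) => [|k].
  by rewrite -preimage_bigcup -TF preimage_setT.
have [mFk Fkoo] := Foo k; split.
  by rewrite -[X in measurable X]setTI; exact: mg.
rewrite /lebesgue_cons /pushforward -comp_preimage (_ : g \o _ = id) //.
exact/funext.
Qed.

HB.instance Definition _ := Measure_isSigmaFinite.Build _ _ _ lebesgue_cons
  lebesgue_cons_sigma_finite.
End successor.

Fixpoint lebesgue_tuple (d : nat) :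
    {sigma_finite_measure set (d.-tuple mR) -> \bar R} :=
  if d is n.+1 then lebesgue_cons (lebesgue_tuple n)
  else \d_([tuple] : 0.-tuple mR).

Lemma lebesgue_tuple_box (d : nat) (A : 'I_d -> set mR) :
  (forall i, measurable (A i)) ->
  lebesgue_tuple d [set x | forall i, A i (tnth x i)] =
  (\prod_(i < d) lebesgue_measure (A i))%E.
Proof.
elim: d A => [|d IHd] A mA.
  by rewrite big_ord0 /= diracE mem_set // => -[].
rewrite big_ord_recl -IHd//= /lebesgue_cons /pushforward.
rewrite -product_measure1E//.
- congr (_ _); apply/seteqP; split => -[x t] /=.
    move=> h; split; first exact: (h ord0).
    by move=> i; have := h (lift ord0 i); rewrite /tuple_of_pair tnthS.
  by move=> [h0 h] i; case: (unliftP ord0 i) => [j ->|->//]; rewrite tnthS.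
- rewrite (_ : mkset _ = \bigcap_(i in [set: 'I_d])
    (fun t : d.-tuple mR => tnth t i) @^-1` A (lift ord0 i)); last first.
    by apply/seteqP; split => t /= h i => [_|]; exact: h.
  apply: fin_bigcap_measurable => // i _.
  by rewrite -[X in measurable X]setTI; exact: measurable_tnth.
Qed.

End LebesgueTuple.

Section FunctionSpace.
Variables (R : realType) (d : nat).
Local Notation mR := (measurableTypeR R).
Local Notation vec := (d.-tuple mR).
Implicit Types (f : vec -> R) (k : d.-tuple int) (x : vec).

Definition unit_cube : set vec :=
  [set x | forall j, 0 <= (tnth x j : R) < 1].

Definition cube_integral f : R :=
  \int[lebesgue_tuple R d]_(x in unit_cube) f x.

Definition cube_cintegral (g : vec -> R[i]) : R[i] :=
  cube_integral (fun x => complex.Re (g x)) +i*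
  cube_integral (fun x => complex.Im (g x)).

Definition dot k x : R := \sum_(j < d) (tnth k j)%:~R * (tnth x j : R).

(* exp (2 pi i t) *)
Definition expi2pi (t : R) : R[i] := cos (2 * pi * t) +i* sin (2 * pi * t).

Definition fourier_coef f k : R[i] :=
  cube_cintegral (fun x => (f x)%:C * expi2pi (- dot k x)).

Definition supp k : {set 'I_d} := [set j | tnth k j != 0]%SET.

(* The minimum is computed in \bar R because its neutral element is +oo; it
   ranges over a nonempty set in the branch where it is used. *)
Definition weight k : \bar R :=
  if supp k == finset.set0 then 1%E else
  maxe 1%E (\big[mine/+oo%E]_(j in supp k) (ln `|tnth k j|%:~R)%:E).

Definition normF f : \bar R :=
  (\esum_(k in [set: d.-tuple int])
     ((Normc.normc (fourier_coef f k))%:E * weight k))%E.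

Definition square_integrable f : Prop :=
  measurable_fun unit_cube f /\
  (\int[lebesgue_tuple R d]_(x in unit_cube) (((f x) ^+ 2)%:E) < +oo)%E.

Definition F_space : set (vec -> R) :=
  [set f | square_integrable f /\ (normF f < +oo)%E].

(* The continuous representative of the class of f, through which the point
   values of f in F_space are defined: the unordered sum over Z^d of the Fourier
   series. It is real because f is, so Re discards nothing. *)
Definition fourier_sum f x : R :=
  complex.Re (summability.sum
        (fun k => (fourier_coef f k * expi2pi (dot k x) : (R[i])^o))).

Definition worst_case_error (Q : (vec -> R) -> R) : \bar R :=
  ereal_sup [set (`|cube_integral f - Q (fourier_sum f)|)%:E
            | f in [set f | F_space f /\ (normF f <= 1)%E]].

Definition qmc (P : seq vec) (f : vec -> R) : R :=
  (size P)%:R^-1 * \sum_(x <- P) f x.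

End FunctionSpace.

Section PointSets.
Variable R : realType.
Local Notation mR := (measurableTypeR R).

(* uphalf M is the ceiling of M / 2 *)
Definition prime_window (M : nat) : seq nat :=
  [seq p <- index_iota (uphalf M).+1 M.+1 | prime p].

Definition frac (x : R) : R := x - (Num.floor x)%:~R.

(* ({a n / q}, {a n^2 / q}, ..., {a n^d / q}) *)
Definition korobov_point (d a n q : nat) : d.-tuple mR :=
  [tuple frac ((a * n ^ j.+1)%:R / q%:R) | j < d].

Definition S_comp (M d : nat) : seq (d.-tuple mR) :=
  [seq korobov_point d 1 n p | p <- prime_window M, n <- iota 0 p].

Definition T_comp (M d : nat) : seq (d.-tuple mR) :=
  [seq korobov_point d 1 n (p ^ 2) | p <- prime_window M, n <- iota 0 (p ^ 2)].

Definition U_comp (M d : nat) : seq (d.-tuple mR) :=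
  flatten [seq [seq korobov_point d k n p | k <- iota 0 p, n <- iota 0 p]
          | p <- prime_window M].

Lemma size_S_comp (M d : nat) :
  size (S_comp M d) = (\sum_(p <- prime_window M) p)%N.
Proof.
rewrite size_allpairs_dep sumnE big_map.
by apply: eq_bigr => p _; rewrite size_iota.
Qed.

Lemma size_T_comp (M d : nat) :
  size (T_comp M d) = (\sum_(p <- prime_window M) p ^ 2)%N.
Proof.
rewrite size_allpairs_dep sumnE big_map.
by apply: eq_bigr => p _; rewrite size_iota.
Qed.

Lemma size_U_comp (M d : nat) :
  size (U_comp M d) = (\sum_(p <- prime_window M) p ^ 2)%N.
Proof.
rewrite size_flatten sumnE /shape !big_map.
by apply: eq_bigr => p _; rewrite size_allpairs !size_iota.
Qed.

Lemma qmc_S_comp (M d : nat) (f : d.-tuple mR -> R) :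
  qmc (S_comp M d) f = (size (S_comp M d))%:R^-1 *
    \sum_(p <- prime_window M) \sum_(0 <= n < p) f (korobov_point d 1 n p).
Proof.
rewrite /qmc; congr (_ * _); rewrite big_allpairs_dep.
by apply: eq_bigr => p _; rewrite /index_iota subn0.
Qed.

Lemma qmc_T_comp (M d : nat) (f : d.-tuple mR -> R) :
  qmc (T_comp M d) f = (size (T_comp M d))%:R^-1 *
    \sum_(p <- prime_window M) \sum_(0 <= n < p ^ 2)
      f (korobov_point d 1 n (p ^ 2)).
Proof.
rewrite /qmc; congr (_ * _); rewrite big_allpairs_dep.
by apply: eq_bigr => p _; rewrite /index_iota subn0.
Qed.

Lemma qmc_U_comp (M d : nat) (f : d.-tuple mR -> R) :
  qmc (U_comp M d) f = (size (U_comp M d))%:R^-1 *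
    \sum_(p <- prime_window M) \sum_(0 <= k < p) \sum_(0 <= n < p)
      f (korobov_point d k n p).
Proof.
rewrite /qmc; congr (_ * _); rewrite big_flatten big_map.
by apply: eq_bigr => p _; rewrite big_allpairs_dep /index_iota subn0.
Qed.

End PointSets.

(* Main.v *)
(* For f in the unit ball, I(f) - Q(f) = - Re (sum over k <> 0 of fhat(k) avg(k)),
   where avg(k) is the average of exp (2 pi i k.x) over the point set, so it is
   enough to bound avg(k) by a constant times the weight of k. The primes p of
   the window dividing all k_j are few: their product divides some nonzero k_j,
   hence there are at most 2 log |k_j| / log M of them, and they are estimated
   trivially. For the other primes the sum is at most d sqrt p (Weil) for
   the S-points, and d p (root counting) for the T- and U-points.

   Weil's bound for g of degree m over F_p is proved inside an algebraic closure.
   With S_r = sum over F_(p^r) of psi (Tr g(x)), the L-function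
   sum_n z^n sum_(h monic of degree n) psi (sum of g over the roots of h)
   is a polynomial of degree < m, whose logarithmic derivative gives
   S_r = - sum_i om_i^r with m - 1 numbers om_i. Stepanov's method bounds
   S_(2h) by a constant times p^h, which forces |om_i| <= sqrt p. *)

Require Import Defs.
From HB Require Import structures.
From mathcomp Require Import all_boot all_order all_algebra all_field.
From mathcomp Require Import ring lra zify.
From mathcomp Require Import complex finmap.
From mathcomp Require Import all_classical all_reals all_analysis.
From mathcomp Require summability.
Set Implicit Arguments.
Unset Strict Implicit.
Unset Printing Implicit Defensive.
Import Order.TTheory GRing.Theory Num.Theory.
Import numFieldNormedType.Exports.
Local Open Scope ring_scope.

(** * Newton's identities *)

(** A p-set cannot tell the frequencies of p Z^d (p^2 Z^d for the T-points) from 0, so a single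
    prime always leaves some k integrated with full error; averaging over many primes limits this to
    the primes dividing k, and the logarithmic weight pays for their number. Such a prime divides
    every nonzero coordinate, so the count may use whichever coordinate is best, hence the minimum
    in the weight. Stepanov's method is run only in even degree because the trace then splits as U +
    U^s, where s is the square root of the field size and U sums the first half of the conjugates of
    g. The degree of U is about m s / p, small enough for U^s to be traded for a - U on the fibre
    over a at little cost. Extension fields are realised as the sets of fixed points of powers of x
    -> x^p in one algebraically closed field, where conjugates, traces and minimal polynomials are
    plain sums and products over powers of x. *)

Section PowerSums.
Variable R : comNzRingType.
Implicit Types (a : R) (s : seq R).

(* The reversal of the product of the 'X - a, see coef_prod_XsubC. *)
Definition revprod s : {poly R} := \prod_(a <- s) (1 - a *: 'X).
Definition power_sum s k : R := \sum_(a <- s) a ^+ k.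

Lemma power_sum0 s : power_sum s 0 = (size s)%:R.
Proof.
rewrite /power_sum -sum1_size natr_sum; apply: eq_bigr => x _; exact: expr0.
Qed.

Lemma coef_revprod_cons0 a s : (revprod (a :: s))`_0 = (revprod s)`_0.
Proof.
by rewrite /revprod big_cons mulrBl mul1r -scalerAl coefB coefZ coefXM mulr0 subr0.
Qed.

Lemma coef_revprod_consS a s j :
  (revprod (a :: s))`_j.+1 = (revprod s)`_j.+1 - a * (revprod s)`_j.
Proof. by rewrite /revprod big_cons mulrBl mul1r -scalerAl coefB coefZ coefXM. Qed.

Lemma coef0_revprod s : (revprod s)`_0 = 1.
Proof.
by elim: s => [|a s IHs]; [rewrite /revprod big_nil coef1 | rewrite coef_revprod_cons0].
Qed.

Lemma coef_revprod_gt s j : (size s < j)%N -> (revprod s)`_j = 0.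
Proof.
elim: s j => [|a s IHs] [|j] //= ltj; first by rewrite /revprod big_nil coef1.
by rewrite coef_revprod_consS !IHs ?mulr0 ?subr0 // ltnW.
Qed.

Lemma newton_identity s j :
  (revprod s)`_j *+ j = - \sum_(l < j) (revprod s)`_(j - l.+1) * power_sum s l.+1.
Proof.
elim: s j => [|a s IHs] [|j]; rewrite ?mulr0n ?big_ord0 ?oppr0 //.
  rewrite /revprod big_nil coef1 mul0rn big1 ?oppr0 // => l _.
  by rewrite /power_sum big_nil mulr0.
(* Coefficientwise, [revprod (a :: s)] divided by [1 - a *: 'X], expanded as a geometric series, is
   [revprod s]. *)
have tele k : \sum_(l < k.+1) (revprod (a :: s))`_(k - l) * a ^+ l.+1
              = a * (revprod s)`_k.
  elim: k => [|k IHk].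
    by rewrite big_ord1 expr1 subn0 coef_revprod_cons0 mulrC.
  rewrite big_ord_recl expr1 subn0 coef_revprod_consS.
  under eq_bigr do rewrite lift0 subSS exprS mulrCA.
  by rewrite -mulr_sumr IHk; ring.
have split_sum : \sum_(l < j.+1) (revprod (a :: s))`_(j - l) * power_sum s l.+1
    = \sum_(l < j.+1) (revprod s)`_(j - l) * power_sum s l.+1
      - a * \sum_(l < j) (revprod s)`_(j - l.+1) * power_sum s l.+1.
  rewrite !big_ord_recr /= subnn coef_revprod_cons0.
  rewrite addrAC; congr (_ + _); rewrite mulr_sumr -sumrB.
  apply: eq_bigr => l _.
  by rewrite -(subnSK (ltn_ord l)) coef_revprod_consS; ring.
rewrite coef_revprod_consS mulrnBl IHs -mulrnAr mulrSr IHs.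
under [X in _ = - X]eq_bigr do
  rewrite subSS /power_sum big_cons mulrDr addrC -/(power_sum _ _).
rewrite big_split /= split_sum tele.
under eq_bigr do rewrite subSS.
by ring.
Qed.

Lemma coef_prod_XsubC s j : (j <= size s)%N ->
  (\prod_(a <- s) ('X - a%:P))`_(size s - j) = (revprod s)`_j.
Proof.
elim: s j => [|a s IHs] /= j.
  by rewrite leqn0 => /eqP->; rewrite /revprod !big_nil.
have szs := size_prod_XsubC s id; rewrite /= in szs.
rewrite big_cons mulrBl coefB coefXM mul_polyC coefZ.
case: j => [|j] lej; last rewrite subSS coef_revprod_consS.
  rewrite subn0 /= coef_revprod_cons0 -IHs // subn0.
  by rewrite [X in _ - _ * X]nth_default ?szs // mulr0 subr0.
rewrite -(IHs j) // subn_eq0; case: (leqP (size s) j) => [le_sj|lt_js].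
  have ej : j = size s by apply/eqP; rewrite eqn_leq le_sj andbT -ltnS.
  rewrite coef_revprod_gt ?ej // !sub0r; congr (- (_ * _)).
rewrite -subn1 -subnDA addn1 -(IHs j.+1) //.
Qed.

(** In Newton's identity of index m, the coefficient of index m enters only through the term
    multiplied by m, and the power sum of index m has coefficient 1. All other terms have lower
    index and agree by induction. *)
Lemma power_sum_revprod_shift s t m : (0 < m)%N ->
  (forall i, (i < m)%N -> (revprod s)`_i = (revprod t)`_i) ->
  power_sum t m - power_sum s m = - ((revprod t)`_m - (revprod s)`_m) *+ m.
Proof.
elim/ltn_ind: m => -[//|m] IHm _ eq_st.
have newtonS u : power_sum u m.+1 = - (revprod u)`_m.+1 *+ m.+1
    - \sum_(l < m) (revprod u)`_(m - l) * power_sum u l.+1.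
  rewrite mulNrn newton_identity opprK big_ord_recr /= subnn coef0_revprod mul1r.
  by rewrite [X in X - _]addrC; under eq_bigr do rewrite subSS; rewrite addrK.
rewrite !newtonS (eq_bigr (fun l : 'I_m => (revprod s)`_(m - l) * power_sum s l.+1)).
  by ring.
move=> l _; rewrite eq_st ?ltnS ?leq_subr //; congr (_ * _).
have ltl := ltn_ord l; apply/eqP; rewrite -subr_eq0 IHm //.
  by rewrite eq_st ?subrr ?mulNrn ?mul0rn ?oppr0.
by move=> i lti; apply: eq_st; apply: (leq_trans lti); exact: leqW.
Qed.
End PowerSums.

(** * Finite fields inside an algebraically closed field *)

Section FrobeniusFixedPoints.
Variables (p : nat) (p_pr : prime p) (Om : closedFieldType).
Variable iota : {rmorphism 'F_p -> Om}.

Lemma pchar_closure : p \in [pchar Om].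
Proof. exact: (rmorph_pchar iota (pchar_Fp p_pr)). Qed.

Local Notation Fr := (pFrobenius_aut pchar_closure).

Lemma pow_frobD k (x y : Om) : (x + y) ^+ (p ^ k) = x ^+ (p ^ k) + y ^+ (p ^ k).
Proof.
apply: exprDn_pchar; rewrite pnatX; apply/orP; left.
by rewrite pnatE //; exact: pchar_closure.
Qed.

Lemma pow_frob_sum k (I : Type) (s : seq I) (P : pred I) (F : I -> Om) :
  (\sum_(i <- s | P i) F i) ^+ (p ^ k) = \sum_(i <- s | P i) F i ^+ (p ^ k).
Proof.
apply: (big_morph (fun x => x ^+ (p ^ k))) => [x y|]; first exact: pow_frobD.
by rewrite expr0n expn_eq0 (gtn_eqF (prime_gt0 p_pr)).
Qed.

Lemma pow_frobA i j (x : Om) : (x ^+ (p ^ i)) ^+ (p ^ j) = x ^+ (p ^ (i + j)).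
Proof. by rewrite -exprM -expnD. Qed.

Lemma pow_frob_inj k : injective (fun x : Om => x ^+ (p ^ k)).
Proof.
move=> x y /= exy; apply/eqP; rewrite -subr_eq0.
have : (x - y) ^+ (p ^ k) = 0.
  apply: (addIr (y ^+ (p ^ k))); rewrite -pow_frobD subrK add0r.
  exact: exy.
by move/eqP; rewrite expf_eq0 => /andP[].
Qed.

(** For r > 0 this is the field with p^r elements inside [Om]. *)
Definition fixpts r : seq Om :=
  sval (closed_field_poly_normal ('X^(p ^ r) - 'X : {poly Om})).

Lemma size_XnsubX r : (0 < r)%N -> size ('X^(p ^ r) - 'X : {poly Om}) = (p ^ r).+1.
Proof.
move=> r_gt0; rewrite size_polyDl ?size_polyXn // size_polyN size_polyX.
by rewrite ltnS -[X in (X < _)%N](expn0 p) ltn_exp2l // prime_gt1.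
Qed.

Lemma fixptsE r : (0 < r)%N ->
  'X^(p ^ r) - 'X = \prod_(x <- fixpts r) ('X - x%:P) :> {poly Om}.
Proof.
move=> r_gt0; rewrite /fixpts; case: closed_field_poly_normal => s /= {1}->.
rewrite (_ : lead_coef _ = 1) ?scale1r // lead_coefE size_XnsubX //=.
rewrite coefB coefXn eqxx coefX -[X in (_ == X)%N](expn0 p) eqn_exp2l ?prime_gt1 //.
by rewrite (gtn_eqF r_gt0) subr0.
Qed.

Lemma mem_fixpts r x : (0 < r)%N -> (x \in fixpts r) = (x ^+ (p ^ r) == x).
Proof.
move=> r_gt0; rewrite -root_prod_XsubC -fixptsE // /root.
by rewrite hornerD hornerN hornerXn hornerX subr_eq0.
Qed.

Lemma size_fixpts r : (0 < r)%N -> size (fixpts r) = (p ^ r)%N.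
Proof.
move=> r_gt0; have := size_XnsubX r_gt0.
by rewrite fixptsE // size_prod_XsubC => -[].
Qed.

Lemma uniq_fixpts r : (0 < r)%N -> uniq (fixpts r).
Proof.
move=> r_gt0; rewrite -separable.separable_prod_XsubC -fixptsE //.
rewrite separable.separable_poly.unlock derivB derivXn derivX.
rewrite -scaler_nat natrX (pcharf0 pchar_closure) expr0n (gtn_eqF r_gt0).
rewrite scale0r sub0r -[X in coprimep _ X]scaleN1r coprimepZr ?coprimep1 //.
by rewrite oppr_eq0 oner_eq0.
Qed.

Lemma Fp_expp (a : 'F_p) : a ^+ p = a.
Proof. by have := expf_card a; rewrite card_Fp. Qed.

Lemma frob_iota k a : iota a ^+ (p ^ k) = iota a.
Proof.
elim: k => [|k IHk]; first by rewrite expn0 expr1.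
by rewrite expnS mulnC exprM IHk -rmorphXn /= Fp_expp.
Qed.

(** The image of [iota] already provides p roots of X^p - X, which has no others. *)
Lemma fixed_iota x : x ^+ p = x -> exists a, x = iota a.
Proof.
move=> fx.
have usub : {subset [seq iota a | a <- enum 'F_p] <= fixpts 1}.
  by move=> _ /mapP[a _ ->]; rewrite mem_fixpts // frob_iota.
have ui : uniq [seq iota a | a <- enum 'F_p].
  by rewrite map_inj_uniq ?enum_uniq //; exact: fmorph_inj.
have [|_ eqi] := uniq_min_size ui usub.
  by rewrite size_fixpts // size_map -cardE card_Fp.
have : x \in fixpts 1 by rewrite mem_fixpts // expn1 fx.
by rewrite -eqi => /mapP[a _ ->]; exists a.
Qed.

(* Inverse of iota on the prime field, with junk value 0 outside. *)
Definition res x : 'F_p := odflt 0 [pick a | iota a == x].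

Lemma resK x : x ^+ p = x -> iota (res x) = x.
Proof.
move=> /fixed_iota[a ->]; rewrite /res; case: pickP => [b /eqP //|/(_ a)].
by rewrite eqxx.
Qed.

Lemma iotaK a : res (iota a) = a.
Proof. by apply: (fmorph_inj iota); rewrite resK // -[X in _ ^+ X]expn1 frob_iota. Qed.

Lemma resD x y : x ^+ p = x -> y ^+ p = y -> res (x + y) = res x + res y.
Proof.
move=> fx fy; rewrite -{1}(resK fx) -{1}(resK fy) -rmorphD; exact: iotaK.
Qed.

Lemma fixed_poly (h : {poly Om}) : map_poly Fr h = h ->
  exists h0, h = map_poly iota h0.
Proof.
move=> fh; exists (\poly_(i < size h) res (h`_i)); apply/polyP => i.
rewrite coef_map coef_poly; case: ltnP => [_|lei].
  by rewrite -{1}(resK (x := h`_i)) // -[in RHS]fh coef_map /= pFrobenius_autE.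
by rewrite nth_default //; exact: (esym (rmorph0 iota)).
Qed.

Definition roots (h : {poly 'F_p}) : seq Om :=
  sval (closed_field_poly_normal (map_poly iota h)).

Lemma rootsE h : h \is monic ->
  map_poly iota h = \prod_(x <- roots h) ('X - x%:P).
Proof.
move=> mh; rewrite /roots; case: closed_field_poly_normal => s /= {1}->.
by rewrite (monicP (_ : map_poly iota h \is monic)) ?scale1r // map_monic.
Qed.

Lemma size_roots h : h \is monic -> size h = (size (roots h)).+1.
Proof.
by move=> mh; rewrite -(size_map_poly iota) rootsE // size_prod_XsubC.
Qed.

Lemma frob_roots h : h \is monic -> perm_eq [seq x ^+ p | x <- roots h] (roots h).
Proof.
move=> mh; apply: prod_XsubC_eq; rewrite -rootsE // big_map.
transitivity (map_poly Fr (map_poly iota h)).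
  by rewrite rootsE // map_prod_XsubC; exact: eq_bigr.
rewrite -map_poly_comp; apply/polyP => i; rewrite !coef_map /=.
by rewrite pFrobenius_autE -[X in _ ^+ X]expn1 frob_iota.
Qed.

Lemma roots_mul h1 h2 : h1 \is monic -> h2 \is monic ->
  perm_eq (roots (h1 * h2)) (roots h1 ++ roots h2).
Proof.
move=> m1 m2; apply: prod_XsubC_eq; rewrite -rootsE ?monicMl // big_cat /=.
by rewrite rmorphM /= !rootsE.
Qed.

End FrobeniusFixedPoints.

(** * The L-function of an additive character *)

Section LFunction.
Variables (p : nat) (p_pr : prime p) (Om : closedFieldType).
Variable iota : {rmorphism 'F_p -> Om}.
Variables (C : fieldType) (psi : 'F_p -> C).
Hypotheses (psi0 : psi 0 = 1) (psiD : {morph psi : a b / a + b >-> a * b}).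
Variable g : {poly 'F_p}.

Local Notation "h ^O" := (map_poly iota h) (at level 2, format "h ^O").
Local Notation fixpts := (fixpts p Om).
Local Notation roots := (roots iota).
Local Notation res := (res iota).

(** Since g has coefficients in ['F_p], the summands are the conjugates g(x)^(p^i) ([horner_frob]).
    For x in [fixpts r] this is therefore the trace of g(x) down to ['F_p], and [char_sum r] is
    S_r. *)
Definition frob_trace r x : 'F_p := res (\sum_(i < r) g^O.[x ^+ (p ^ i)]).
Definition root_sum h : 'F_p := res (\sum_(x <- roots h) g^O.[x]).
Definition char_sum r : C := \sum_(x <- fixpts r) psi (frob_trace r x).

Definition monics n : seq {poly 'F_p} := [seq 'X^n + rVpoly t | t : 'rV['F_p]_n].
Definition Lcoef n : C := \sum_(h <- monics n) psi (root_sum h).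

(** For x in F_(p^r) this is the characteristic polynomial of x over F_p, a power of its minimal
    polynomial. *)
Definition orbit_poly r (x : Om) : {poly Om} := \prod_(i < r) ('X - (x ^+ (p ^ i))%:P).

Lemma horner_frob k (h : {poly 'F_p}) x : h^O.[x] ^+ (p ^ k) = h^O.[x ^+ (p ^ k)].
Proof.
rewrite !horner_coef (pow_frob_sum p_pr iota); apply: eq_bigr => i _.
by rewrite exprMn coef_map /= frob_iota // exprAC.
Qed.

Lemma root_sum_fixed h : h \is monic ->
  (\sum_(x <- roots h) g^O.[x]) ^+ p = \sum_(x <- roots h) g^O.[x].
Proof.
move=> mh; rewrite -[X in _ ^+ X]expn1 (pow_frob_sum p_pr iota).
rewrite -[RHS](perm_big _ (frob_roots p_pr iota mh)) /= big_map.
by apply: eq_bigr => x _; rewrite horner_frob expn1.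
Qed.

Lemma iota_root_sum h : h \is monic ->
  iota (root_sum h) = \sum_(x <- roots h) g^O.[x].
Proof. by move=> mh; rewrite resK // root_sum_fixed. Qed.

Lemma root_sumM h1 h2 : h1 \is monic -> h2 \is monic ->
  root_sum (h1 * h2) = root_sum h1 + root_sum h2.
Proof.
move=> m1 m2; rewrite -resD // ?root_sum_fixed //.
by congr res; rewrite -big_cat; apply: perm_big; exact: roots_mul.
Qed.

Lemma mem_monics n h : (h \in monics n) = (h \is monic) && (size h == n.+1).
Proof.
apply/fintype.imageP/andP => [[t _ ->]|[mh /eqP szh]].
  have sz : (size (rVpoly t) < size ('X^n : {poly 'F_p}))%N.
    by rewrite size_polyXn ltnS size_poly.
  by rewrite monicE lead_coefDl // lead_coefXn size_polyDl // size_polyXn.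
exists (poly_rV (h - 'X^n)%R : 'rV_n) => //; rewrite poly_rV_K ?subrKC //.
have le : (size (h - 'X^n)%R <= n.+1)%N.
  by rewrite (leq_trans (size_polyD _ _)) // size_polyN size_polyXn szh maxnn.
apply/leq_sizeP => j; rewrite leq_eqVlt => /predU1P[<-|ltj].
  by rewrite coefB coefXn eqxx -[n]/(n.+1.-1) -szh -lead_coefE (monicP mh) subrr.
by move/leq_sizeP: le; apply.
Qed.

Lemma uniq_monics n : uniq (monics n).
Proof.
by rewrite map_inj_uniq ?enum_uniq // => u v /addrI/(can_inj (@rVpolyK _ n)).
Qed.

Lemma big_monics_dvd n r c (F : {poly 'F_p} -> C) :
  c \is monic -> size c = r.+1 -> (r <= n)%N ->
  \sum_(h <- monics n | c %| h) F h = \sum_(h <- monics (n - r)) F (c * h).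
Proof.
move=> mc szc le_rn; rewrite -big_filter -(big_map ( *%R c) xpredT F); apply: perm_big.
have c0 : c != 0 by rewrite monic_neq0.
apply: uniq_perm; first by rewrite filter_uniq ?uniq_monics.
  by rewrite map_inj_uniq ?uniq_monics //; exact: mulfI.
move=> h; rewrite mem_filter mem_monics; apply/andP/mapP.
  case=> /dvdpP[q ->] /andP[mqc /eqP sz]; exists q; last by rewrite mulrC.
  have mq : q \is monic by rewrite -(monicMr q mc).
  rewrite mem_monics mq /=; move: sz; rewrite size_monicM ?monic_neq0 // szc.
  by rewrite addnS /= => e; rewrite -(addnK r (size q)) e subSn.
case=> q; rewrite mem_monics => /andP[mq /eqP szq] ->.
rewrite dvdp_mulr // monicMl // mq size_Mmonic // szq szc; split=> //.
by apply/eqP; lia.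
Qed.

Lemma size_orbit_poly r x : size (orbit_poly r x) = r.+1.
Proof. by rewrite size_prod_XsubC /index_enum -enumT size_enum_ord. Qed.

Lemma orbit_poly_monic r x : orbit_poly r x \is monic.
Proof. exact: monic_prod_XsubC. Qed.

Lemma orbit_polyE r x :
  orbit_poly r x = \prod_(y <- [seq x ^+ (p ^ i) | i <- seq.iota 0 r]) ('X - y%:P).
Proof. by rewrite big_map -{2}[r]subn0 -/(index_iota 0 r) big_mkord. Qed.

Lemma orbit_polyD r1 r2 x : x ^+ (p ^ r1) = x ->
  orbit_poly (r1 + r2) x = orbit_poly r1 x * orbit_poly r2 x.
Proof.
move=> fx; rewrite {1}/orbit_poly big_split_ord /=; congr (_ * _).
by apply: eq_bigr => i _; rewrite -pow_frobA fx.
Qed.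

Lemma root_orbit_poly r x : (0 < r)%N -> root (orbit_poly r x) x.
Proof.
case: r => // r _; rewrite orbit_polyE root_prod_XsubC /=.
by rewrite expn0 expr1 mem_head.
Qed.

Lemma orbit_poly_fixed r x : x ^+ (p ^ r) = x ->
  exists2 c, c \is monic & orbit_poly r x = c^O.
Proof.
move=> fx; have [|c ec] := @fixed_poly p p_pr Om iota (orbit_poly r x).
  rewrite /orbit_poly map_prod_XsubC /=.
  case: r fx => [|r] fx; first by rewrite !big_ord0.
  rewrite big_ord_recr [RHS]big_ord_recl /= mulrC; congr (_ * _).
    by rewrite pFrobenius_autE -exprM -expnSr fx expn0 expr1.
  by apply: eq_bigr => i _; rewrite pFrobenius_autE -exprM -expnSr.
by exists c => //; rewrite -(map_monic iota) -ec orbit_poly_monic.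
Qed.

Lemma root_sum_orbit r x c : c \is monic -> orbit_poly r x = c^O ->
  root_sum c = frob_trace r x.
Proof.
move=> mc ec; congr res.
have /(perm_big _)-> : perm_eq (roots c) [seq x ^+ (p ^ i) | i <- seq.iota 0 r].
  by apply: prod_XsubC_eq; rewrite -rootsE // -ec orbit_polyE.
by rewrite big_map -{1}[r]subn0 -/(index_iota 0 r) big_mkord.
Qed.

Lemma root_frob h k x : root h^O x -> root h^O (x ^+ (p ^ k)).
Proof.
move=> /rootP hx; apply/rootP; rewrite -horner_frob hx expr0n expn_eq0.
by rewrite (gtn_eqF (prime_gt0 p_pr)).
Qed.

(** The list [s] of conjugates is one longer than the list of roots of h, so two conjugates
    coincide, and injectivity of Frobenius cancels the smaller exponent. *)
Lemma root_fixed h x : h \is monic -> root h^O x ->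
  exists2 r, (0 < r < size h)%N & x ^+ (p ^ r) = x.
Proof.
move=> mh hx; pose s := [seq x ^+ (p ^ i) | i <- seq.iota 0 (size h)].
have sub : {subset s <= roots h}.
  move=> _ /mapP[i _ ->]; rewrite -root_prod_XsubC -rootsE //.
  exact: root_frob.
have /(uniqPn 0)[i [j []]] : ~~ uniq s.
  apply/negP => /uniq_leq_size/(_ sub).
  by rewrite size_map size_iota (size_roots iota mh) ltnn.
rewrite size_map size_iota => ltij ltj.
rewrite !(nth_map 0%N) ?size_iota ?(ltn_trans ltij) // !nth_iota ?(ltn_trans ltij) //.
rewrite !add0n -{1}(subnK (ltnW ltij)) => e.
exists (j - i)%N; first by rewrite subn_gt0 ltij (leq_ltn_trans (leq_subr _ _)).
by apply: (pow_frob_inj p_pr iota (k := i)); rewrite pow_frobA.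
Qed.

(** With d the least period, the d conjugates of x are distinct: this gives both the divisibility
    and the multiplicity one. Thus [orbit_poly d x] is the minimal polynomial of x. *)
Lemma minimal_period h x : h \is monic -> root h^O x ->
  exists d, [/\ (0 < d < size h)%N, x ^+ (p ^ d) = x, orbit_poly d x %| h^O,
    mup x (orbit_poly d x) = 1%N &
    forall r, (0 < r < d)%N -> x ^+ (p ^ r) <> x].
Proof.
move=> mh hx; have [r0 /andP[r0_gt0 r0_lt] fr0] := root_fixed mh hx.
have ex_per : exists r, (0 < r)%N && (x ^+ (p ^ r) == x).
  by exists r0; rewrite r0_gt0 fr0 eqxx.
case: (ex_minnP ex_per) => d /andP[d_gt0 /eqP fd] dmin.
have dmin' r : (0 < r < d)%N -> x ^+ (p ^ r) <> x.
  move=> /andP[r_gt0 ltrd] fr; have := dmin r.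
  by rewrite r_gt0 fr eqxx /= leqNgt ltrd => /(_ isT).
have us : uniq [seq x ^+ (p ^ i) | i <- seq.iota 0 d].
  apply/(uniqP 0) => i j; rewrite !inE size_map size_iota => ltid ltjd.
  rewrite !(nth_map 0%N) ?size_iota // !nth_iota // !add0n.
  wlog ltij : i j ltid ltjd / (i < j)%N => [hwlog e|e].
    case: (ltngtP i j) => // lt; first exact: hwlog.
    by apply/esym/hwlog.
  exfalso; apply: (dmin' (j - i)%N).
    by rewrite subn_gt0 ltij (leq_ltn_trans (leq_subr _ _)).
  apply: (pow_frob_inj p_pr iota (k := i)); rewrite pow_frobA.
  by rewrite subnK // ltnW.
exists d; split=> //.
- rewrite d_gt0 (leq_ltn_trans _ r0_lt) //; apply: dmin.
  by rewrite r0_gt0 fr0 eqxx.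
- rewrite orbit_polyE; apply: uniq_roots_dvdp; last by rewrite uniq_rootsE.
  by apply/allP => _ /mapP[i _ ->]; exact: root_frob.
- rewrite orbit_polyE mu_prod_XsubC count_uniq_mem //.
  rewrite -root_prod_XsubC -orbit_polyE.
  by rewrite root_orbit_poly.
Qed.

(* If d is the period of x and P its minimal polynomial over F_p, then
   orbit_poly (d * e) x = P ^+ e, so the r that are counted are d, 2d, ..., mu d. *)
Lemma count_orbit_dvd N h x : h \is monic -> (size h <= N.+1)%N ->
  (\sum_(1 <= r < N.+1) ((x ^+ (p ^ r) == x) && (orbit_poly r x %| h^O)%R))%N
    = mup x h^O.
Proof.
elim/ltn_ind: N h => N IHN h mh szh.
have h0 : h^O != 0 by rewrite map_poly_eq0 monic_neq0.
have [hx|hx] := boolP (root h^O x); last first.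
  rewrite mupNroot // big_nat big1 // => r /andP[r_gt0 _].
  case: eqP => //= _; case: dvdpP => // -[q eq]; case/negP: hx.
  by rewrite eq rootM root_orbit_poly ?orbT.
have [d [/andP[d_gt0 ltdh] fd dvd mu1 dmin]] := minimal_period mh hx.
have leqdN : (d <= N)%N by rewrite -ltnS (leq_trans ltdh).
have [c mc ec] := orbit_poly_fixed fd.
have szc : size c = d.+1 by rewrite -(size_map_poly iota) -ec size_orbit_poly.
have [h1 eh] : exists h1, h = h1 * c by apply/dvdpP; rewrite -(dvdp_map iota) -ec.
have mh1 : h1 \is monic by rewrite -(monicMr h1 mc) -eh.
have szh1 : size h = (size h1 + d)%N.
  by rewrite eh size_Mmonic ?monic_neq0 // szc addnS.
have eO : h^O = orbit_poly d x * h1^O by rewrite eh rmorphM /= mulrC ec.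
have oN0 : orbit_poly d x != 0 by rewrite monic_neq0 // orbit_poly_monic.
have h1N0 : h1^O != 0 by rewrite map_poly_eq0 monic_neq0.
have lt_Nd : (N - d < N)%N by rewrite ltn_subrL d_gt0 (leq_trans d_gt0).
have le_h1 : (size h1 <= (N - d).+1)%N.
  by rewrite -(leq_add2r d) -szh1 addSn subnK.
rewrite eO mupM // mu1 -eO -(IHN (N - d)%N lt_Nd h1 mh1 le_h1).
(* No r below d counts, r = d counts once, and for r = d + r' cancelling [orbit_poly d x] leaves the
   condition on r' for the quotient h1. *)
rewrite (@big_cat_nat _ _ _ d) //=; last exact: leqW.
rewrite big_nat big1 ?add0n; last by move=> r /dmin/eqP/negbTE->.
rewrite big_ltn // fd eqxx dvd; congr (_ + _)%N.
rewrite -{1}(add1n d) big_addn subSn //; apply: eq_big_nat => r _.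
by rewrite addnC -pow_frobA fd orbit_polyD // eO dvdp_mul2l.
Qed.

(** After exchanging the sums, each distinct root of h contributes its multiplicity, and these add
    up to the degree. It is the analogue of the identity log n = sum of Lambda(d) over the divisors
    d of n. *)
Lemma total_orbit_count n h : h \in monics n ->
  (\sum_(1 <= r < n.+1) \sum_(x <- fixpts r) (orbit_poly r x %| h^O)%R)%N = n.
Proof.
rewrite mem_monics => /andP[mh /eqP szh].
have sz_roots : size (roots h) = n by have := size_roots iota mh; rewrite szh => -[].
transitivity (\sum_(x <- undup (roots h)) mup x h^O)%N; last first.
  rewrite -[RHS]sz_roots -(sum1_size (roots h)) -[RHS]big_undup_iterop_count /=.
  apply: eq_bigr => x _; rewrite rootsE // mu_prod_XsubC.
  by elim: (count_mem x _) => // -[|k] //= <-.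
under [RHS]eq_bigr do rewrite -(@count_orbit_dvd n) ?szh //.
rewrite exchange_big; apply: eq_big_nat => r /andP[r_gt0 _].
pose dvd x := (orbit_poly r x %| h^O)%R.
rewrite -(big_mkcond dvd (fun=> 1%N)) -big_filter.
rewrite -(big_mkcond (fun x => (x ^+ (p ^ r) == x)%R && dvd x) (fun=> 1%N)).
rewrite -[RHS]big_filter; apply: perm_big; apply: uniq_perm.
- by rewrite filter_uniq ?uniq_fixpts.
- by rewrite filter_uniq ?undup_uniq.
move=> x; rewrite !mem_filter mem_fixpts // andbC -andbA; congr (_ && _).
rewrite andb_idr // => /(dvdp_trans _) h_dvd; rewrite mem_undup.
rewrite -root_prod_XsubC -rootsE // -dvdp_XsubCl; apply: h_dvd.
by rewrite dvdp_XsubCl root_orbit_poly.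
Qed.

(* Coefficientwise form of z L'(z) = L(z) sum_r S_r z^r: by total_orbit_count, a
   monic h of degree n has n factorizations h = orbit_poly r x * h'. *)
Lemma Lcoef_recurrence n :
  Lcoef n *+ n = \sum_(1 <= r < n.+1) char_sum r * Lcoef (n - r).
Proof.
transitivity (\sum_(h <- monics n) \sum_(1 <= r < n.+1)
    \sum_(x <- fixpts r) (psi (root_sum h) *+ (orbit_poly r x %| h^O)%R)).
  rewrite -sumrMnl [LHS]big_seq [RHS]big_seq; apply: eq_bigr => h hn.
  rewrite -[in LHS](total_orbit_count hn) -sumrMnr; apply: eq_bigr => r _.
  by rewrite sumrMnr.
rewrite exchange_big; apply: eq_big_nat => r /andP[r_gt0 le_rn].
rewrite exchange_big /= mulr_suml [LHS]big_seq [RHS]big_seq.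
apply: eq_bigr => x; rewrite mem_fixpts // => /eqP fx.
have [c mc ec] := orbit_poly_fixed fx.
have szc : size c = r.+1 by rewrite -(size_map_poly iota) -ec size_orbit_poly.
under eq_bigr do rewrite ec dvdp_map mulrb.
rewrite -big_mkcond (big_monics_dvd _ mc szc le_rn) mulr_sumr.
rewrite [LHS]big_seq [RHS]big_seq; apply: eq_bigr => h.
rewrite mem_monics => /andP[mh _].
by rewrite root_sumM // psiD (root_sum_orbit mc ec).
Qed.

Lemma Lcoef0 : Lcoef 0 = 1.
Proof.
have e : perm_eq (monics 0) [:: 1].
  apply: uniq_perm; rewrite ?uniq_monics // => h; rewrite mem_monics inE.
  apply/andP/eqP => [[mh /eqP szh]|->]; last by rewrite monic1 size_poly1.
  have h0 := size1_polyC (eq_leq szh).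
  by move/monicP: mh; rewrite h0 lead_coefC => ->.
rewrite /Lcoef (perm_big _ e) big_seq1 (_ : root_sum 1 = 0) ?psi0 // -(iotaK p_pr iota 0).
congr res; rewrite rmorph0 (_ : roots 1 = [::]) ?big_nil //.
by apply/size0nil; apply: succn_inj; rewrite -size_roots ?monic1 // size_poly1.
Qed.

Lemma root_sumE h : h \is monic ->
  iota (root_sum h) = \sum_(i < size g) iota g`_i * power_sum (roots h) i.
Proof.
move=> mh; rewrite iota_root_sum //.
under eq_bigr do rewrite horner_coef size_map_poly.
rewrite exchange_big; apply: eq_bigr => i _; rewrite mulr_sumr.
by apply: eq_bigr => x _; rewrite coef_map.
Qed.

Lemma coef_roots h n j : h \in monics n -> (j <= n)%N ->
  (revprod (roots h))`_j = iota h`_(n - j).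
Proof.
rewrite mem_monics => /andP[mh /eqP szh] lejn.
have sz_roots : size (roots h) = n by have := size_roots iota mh; rewrite szh => -[].
by rewrite -coef_prod_XsubC ?sz_roots // -rootsE // coef_map.
Qed.

(* By Newton's identities, the coefficient of 'X^(n - deg g) affects the power
   sums of the roots of degree <= deg g only in degree deg g, and linearly. *)
Lemma root_sum_shift n c h : (1 < size g <= n.+1)%N -> h \in monics n ->
  let h' := h + c *: 'X^(n.+1 - size g) in
  h' \in monics n /\
  root_sum h' = root_sum h - lead_coef g * c *+ (size g).-1.
Proof.
move=> /andP[szg_gt1 szg_le] hn h'.
have szg : size g = (size g).-1.+1 by rewrite (ltn_predK szg_gt1).
set m := (size g).-1 in szg *.
have m_gt0 : (0 < m)%N by rewrite -ltnS -szg.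
have le_mn : (m <= n)%N by rewrite -ltnS -szg.
have h'n : h' \in monics n.
  move: hn; rewrite !mem_monics => /andP[mh /eqP szh].
  have lt_sz : (size (c *: 'X^(n.+1 - size g)) < size h)%N.
    rewrite (leq_ltn_trans (size_scale_leq _ _)) // size_polyXn szh ltnS szg subSS.
    by rewrite ltn_subrL m_gt0 (leq_trans m_gt0).
  by rewrite monicE lead_coefDl // -monicE mh size_polyDl // szh eqxx.
have coef' j : (j <= n)%N ->
    (revprod (roots h'))`_j = (revprod (roots h))`_j + iota c *+ (j == m).
  move=> lejn; rewrite !(coef_roots _ lejn) // coefD rmorphD coefZ coefXn szg subSS.
  rewrite (eqn_sub2lE lejn le_mn); case: (j == m); first by rewrite mulr1.
  by rewrite mulr0 rmorph0.
split=> //; apply: (fmorph_inj iota).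
move: (hn) (h'n); rewrite !mem_monics => /andP[mh szh] /andP[mh' szh'].
apply/eqP; rewrite -subr_eq0 rmorphB rmorphMn rmorphM /= !root_sumE // szg.
have szr (u : {poly 'F_p}) : u \is monic -> size u == n.+1 -> size (roots u) = n.
  by move=> mu /eqP szu; have := size_roots iota mu; rewrite szu => -[].
have low i : (i < m)%N -> power_sum (roots h') i = power_sum (roots h) i.
  case: i => [|i] lti; first by rewrite !power_sum0 !szr.
  apply/eqP; rewrite -subr_eq0 power_sum_revprod_shift // => [|j ltj].
    rewrite coef' ?(leq_trans (ltnW lti)) // (ltn_eqF lti) addr0 subrr.
    by rewrite mulNrn mul0rn oppr0.
  by rewrite coef' ?(ltn_eqF (ltn_trans ltj lti)) ?addr0 //
    (leq_trans (ltnW (ltn_trans ltj lti))).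
have top : power_sum (roots h') m = power_sum (roots h) m - iota c *+ m.
  rewrite -[LHS](subrK (power_sum (roots h) m)) power_sum_revprod_shift //.
    by rewrite coef' // eqxx [_ + iota c]addrC addrK mulNrn addrC.
  by move=> j ltj; rewrite coef' ?(ltn_eqF ltj) ?addr0 // (leq_trans (ltnW ltj)).
rewrite !big_ord_recr /= top (eq_bigr (fun i : 'I_m => iota g`_i *
  power_sum (roots h) i)) => [|i _]; last by rewrite low.
by rewrite /lead_coef -/m mulrBr mulrnAr; apply/eqP; ring.
Qed.

Hypothesis psi_nontrivial : psi 1 != 1.

(** Adding [c *: 'X^(n.+1 - size g)] permutes the monic polynomials of degree n and, for the chosen
    c, raises every [root_sum] by 1. So the sum equals itself times [psi 1], which is not 1. Solving
    for c requires deg g to be invertible in ['F_p]. *)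
Lemma Lcoef_eq0 n : (1 < size g <= n.+1)%N -> (size g).-1%:R != 0 :> 'F_p ->
  Lcoef n = 0.
Proof.
move=> szg mN0; pose c := - (lead_coef g * (size g).-1%:R)^-1.
have lN0 : lead_coef g * (size g).-1%:R != 0.
  by rewrite mulf_neq0 // lead_coef_eq0 -size_poly_gt0 ltnW //; case/andP: szg.
have key h : h \in monics n ->
    (h + c *: 'X^(n.+1 - size g) \in monics n) /\
    root_sum (h + c *: 'X^(n.+1 - size g)) = root_sum h + 1.
  move=> hn; have [h'n ->] := root_sum_shift c szg hn; split=> //.
  rewrite -mulrnAl -[lead_coef g *+ _]mulr_natr.
  by rewrite /c mulrN opprK mulfV.
have shift_inj : injective (fun h => h + c *: 'X^(n.+1 - size g)) by exact: addIr.
have shift_perm : perm_eq [seq h + c *: 'X^(n.+1 - size g) | h <- monics n] (monics n).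
  have umap : uniq [seq h + c *: 'X^(n.+1 - size g) | h <- monics n].
    by rewrite map_inj_uniq ?uniq_monics.
  have sub : {subset [seq h + c *: 'X^(n.+1 - size g) | h <- monics n] <= monics n}.
    by move=> _ /mapP[h /key[? _] ->].
  have [|_ eqi] := uniq_min_size umap sub; first by rewrite [leqRHS]size_map.
  by rewrite uniq_perm ?uniq_monics.
have : Lcoef n = Lcoef n * psi 1.
  rewrite {1}/Lcoef -(perm_big _ shift_perm) big_map mulr_suml.
  rewrite [LHS]big_seq [RHS]big_seq; apply: eq_bigr => h /key[_ ->].
  by rewrite psiD.
move/eqP; rewrite -{1}[Lcoef n]mulr1 -subr_eq0 -mulrBr mulf_eq0 subr_eq0.
by rewrite [1 == _]eq_sym (negbTE psi_nontrivial) orbF => /eqP.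
Qed.

End LFunction.

(** * Tools for Stepanov's method: dimension counting and orders of vanishing *)

Lemma kernel_nonzero (F : fieldType) n m (f : {linear 'rV[F]_n -> 'rV[F]_m}) :
  (m < n)%N -> exists2 v, v != 0 & f v = 0.
Proof.
move=> lt_mn; have : kermx (lin1_mx f) != 0.
  by rewrite -mxrank_eq0 mxrank_ker subn_eq0 -ltnNge (leq_ltn_trans (rank_leq_col _)).
move=> kN0; exists (nz_row (kermx (lin1_mx f))); first by rewrite nz_row_eq0.
by rewrite -mul_rV_lin1; apply/sub_kermxP; exact: nz_row_sub.
Qed.

(** A nonzero term of largest size could not be cancelled by the others, which are all strictly
    smaller. *)
Lemma sum_distinct_size_eq0 (R : nzRingType) (I : finType) (F : I -> {poly R}) :
  (forall i j, F i != 0 -> F j != 0 -> size (F i) = size (F j) -> i = j) ->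
  \sum_i F i = 0 -> forall i, F i = 0.
Proof.
move=> inj_size sum0 i0; apply/eqP/negPn/negP => Fi0.
case: (arg_maxnP (P := fun i => F i != 0) (fun i => size (F i)) Fi0) => i Fi max_i.
have : size (F i) = size (\sum_(j | j != i) F j).
  move: sum0; rewrite (bigD1 i) //= => /eqP; rewrite addr_eq0 => /eqP->.
  by rewrite size_polyN.
apply/eqP; rewrite gtn_eqF //; apply: (leq_ltn_trans (size_sum _ _ _)).
apply: (big_ind (fun k => (k < size (F i))%N)) => [|u v|j neq_ji].
- by rewrite lt0n size_poly_eq0.
- by rewrite gtn_max => -> ->.
have [-> | Fj] := eqVneq (F j) 0; first by rewrite size_poly0 lt0n size_poly_eq0.
have le_ji : (size (F j) <= size (F i))%N by exact: max_i.
rewrite ltn_neqAle le_ji andbT; apply: contraNneq neq_ji => e.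
by apply/eqP/inj_size.
Qed.

Lemma taylor_poly (R : comNzRingType) (P : {poly R}) x :
  P = \sum_(i < size P) P^`N(i).[x] *: ('X - x%:P) ^+ i.
Proof.
have {1}-> : P = (map_poly polyC P).[x%:P + ('X - x%:P)].
  by rewrite addrC subrK -[RHS]/(P \Po 'X) comp_polyXr.
rewrite nderiv_taylor; last exact: mulrC.
rewrite (size_map_inj_poly (@polyC_inj R)) //; apply: eq_bigr => i _.
by rewrite nderivn_map horner_map mul_polyC.
Qed.

(** Divided (Hasse) derivatives give the Taylor expansion in every characteristic, whereas ordinary
    derivatives of order at least p vanish identically in characteristic p and miss the
    multiplicity. *)
Lemma dvdp_nderivn (F : fieldType) (P : {poly F}) x l :
  (forall i, (i < l)%N -> P^`N(i).[x] = 0) -> ('X - x%:P) ^+ l %| P.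
Proof.
move=> P0; rewrite [P in _ %| P](taylor_poly P x).
apply: (big_ind (dvdp (('X - x%:P) ^+ l))) => [|u v du dv|i _].
- exact: dvdp0.
- exact: dvdp_add.
have [lt_il|le_li] := ltnP i l; first by rewrite P0 // scale0r dvdp0.
by rewrite -mul_polyC dvdp_mull // dvdp_exp2l.
Qed.

Lemma size_dvd_multiplicity (F : fieldType) (Z : seq F) (P : {poly F}) l :
  uniq Z -> P != 0 -> {in Z, forall x, ('X - x%:P) ^+ l %| P} ->
  (size Z * l < size P)%N.
Proof.
elim: Z P => [|z Z IHZ] P /=; first by rewrite mul0n size_poly_gt0.
move=> /andP[zZ uZ] P0 dvdP.
have /dvdpP[q eP] := dvdP z (mem_head _ _).
have q0 : q != 0 by apply: contraNneq P0 => q0; rewrite eP q0 mul0r.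
rewrite eP size_Mmonic ?monicXn ?monic_exp ?monicXsubC // size_exp_XsubC addnS /=.
rewrite mulSn addnC ltn_add2r; apply: IHZ => // x xZ.
have := dvdP x; rewrite inE xZ orbT => /(_ isT); rewrite eP Gauss_dvdpl //.
apply/coprimep_expl/coprimep_expr; rewrite coprimep_XsubC root_XsubC.
by apply: contraNneq zZ => ez; move: xZ; rewrite ez.
Qed.

Section Congruence.
Variables (F : fieldType) (D : {poly F}).

Lemma congrpM A A' B B' : D %| A - A' -> D %| B - B' -> D %| A * B - A' * B'.
Proof.
move=> dA dB; rewrite (_ : _ - _ = (A - A') * B + A' * (B - B')); last by ring.
by apply: dvdp_add; [exact: dvdp_mulr | exact: dvdp_mull].
Qed.

Lemma congrpX A A' n : D %| A - A' -> D %| A ^+ n - A' ^+ n.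
Proof.
move=> dA; elim: n => [|n IHn]; first by rewrite subrr dvdp0.
by rewrite !exprS congrpM.
Qed.
End Congruence.

Lemma eqn_mod_coprimeMl p m i j : coprime p m ->
  (m * i == m * j %[mod p])%N -> (i = j %[mod p])%N.
Proof.
move=> co_pm; wlog le_ij : i j / (i <= j)%N => [hwlog e|].
  have [le_ij|lt_ji] := leqP i j; first exact: hwlog.
  by apply/esym/hwlog; [exact: ltnW | rewrite eq_sym].
rewrite eq_sym eqn_mod_dvd ?leq_mul2l ?le_ij ?orbT // -mulnBr Gauss_dvdr //.
by rewrite -eqn_mod_dvd // => /eqP.
Qed.

(** * Stepanov's method *)

Section Stepanov.
Variables (p : nat) (p_pr : prime p) (Om : closedFieldType).
Variable iota : {rmorphism 'F_p -> Om}.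
Variables (g : {poly 'F_p}) (a : 'F_p) (h : nat).
Let m := (size g).-1.
Hypotheses (m_gt0 : (0 < m)%N) (co_pm : coprime p m).
(** The extension has degree 2(h + 1) and Q = s^2 elements, so a fibre of its trace has E = Q / p
    elements on average. The order of vanishing l falls short of s by b, B bounds the size of a
    constraint, N is the number of blocks and E bounds their size. *)
Let w := (p ^ h)%N.
Let s := (p ^ h.+1)%N.
Let E := (w * s)%N.
Let Q := (s * s)%N.
Let b := (p * m).+1.
Let l := (s - b)%N.
Let B := (w * (s + b))%N.
Let G := map_poly iota g.
Let U := \sum_(i < h.+1) G ^+ (p ^ i).
Let N := (w * p)%N.

Let p_gt0 : (0 < p)%N := prime_gt0 p_pr.
Let w_gt0 : (0 < w)%N. Proof. by rewrite expn_gt0 p_gt0. Qed.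
Let s_gt0 : (0 < s)%N. Proof. by rewrite expn_gt0 p_gt0. Qed.
Let E_gt0 : (0 < E)%N. Proof. by rewrite muln_gt0 w_gt0. Qed.
Let sE : s = (w * p)%N. Proof. by rewrite /s expnSr. Qed.
Let QE : Q = (p * E)%N. Proof. by rewrite /Q /E {1}sE; lia. Qed.

Let size_G : size G = m.+1.
Proof. by rewrite size_map_poly; move: m_gt0; rewrite /m; case: (size g). Qed.

Let size_GX i : size (G ^+ i) = (m * i).+1.
Proof.
have G0 : G != 0 by rewrite -size_poly_gt0 size_G.
have := size_exp G i; rewrite size_G /= => <-.
by rewrite prednK // size_poly_gt0 expf_neq0.
Qed.

Lemma size_trace_half : size U = (m * w).+1.
Proof.
rewrite /U big_ord_recr /= addrC size_polyDl size_GX //.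
rewrite ltnS (leq_trans (size_sum _ _ _)) //; apply/bigmax_leqP => i _.
by rewrite size_GX ltn_pmul2l // ltn_exp2l // prime_gt1.
Qed.

(* The auxiliary polynomial is the sum over j < p, i < w of
   e_(i,j) * (U ^+ s) ^+ j * 'X^(i * Q) with size e_(i,j) <= E, where (i, j) is
   encoded as k = i * p + j. Since s and Q are powers of p, U ^+ s and 'X^Q agree
   modulo ('X - x) ^+ s with constants, which are iota a - U.[x] and x when x lies
   in the fibre of the trace over a. Vanishing at x to order l is then implied by
   l linear conditions, namely that the polynomials constraint v i are zero. *)
Definition weight_poly (k : 'I_N) : {poly Om} :=
  ((iota a)%:P - U) ^+ (k %% p) * 'X^(k %/ p).

Definition block (v : 'rV[Om]_(N * E)) (k : 'I_N) : {poly Om} :=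
  rVpoly (row k (vec_mx v)).

Definition constraint (v : 'rV[Om]_(N * E)) (i : nat) : {poly Om} :=
  \sum_k (block v k)^`N(i) * weight_poly k.

Definition constraint_row (v : 'rV[Om]_(N * E)) : 'rV[Om]_(l * B) :=
  mxvec (\matrix_(i < l, j < B) (constraint v i)`_j).

Lemma constraintP c u v i :
  constraint (c *: u + v) i = c *: constraint u i + constraint v i.
Proof.
rewrite /constraint scaler_sumr -big_split; apply: eq_bigr => k _ /=.
by rewrite /block !linearP /= mulrDl scalerAl.
Qed.

Lemma constraint_row_linear : linear constraint_row.
Proof.
move=> c u v; rewrite /constraint_row -linearP; congr mxvec.
by apply/matrixP => i j; rewrite !mxE constraintP coefD coefZ.
Qed.

HB.instance Definition _ :=
  GRing.isLinear.Build _ _ _ _ constraint_row constraint_row_linear.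

Lemma size_weight_poly k : (size (weight_poly k) <= m * w * (k %% p) + k %/ p + 1)%N.
Proof.
apply: (leq_trans (size_polyMleq _ _)); rewrite size_polyXn addnS /=.
rewrite [leqRHS]addnAC leq_add2r addn1.
apply: (leq_trans (size_poly_exp_leq _ _)); rewrite ltnS leq_mul2r; apply/orP; right.
have : (size ((iota a)%:P - U)%R <= (m * w).+1)%N.
  rewrite (leq_trans (size_polyD _ _)) // size_polyN size_trace_half geq_max leqnn andbT.
  by rewrite (leq_trans (size_polyC_leq1 _)).
by case: (size _).
Qed.

(** This fixes b: a block has size at most E = w * s, and its weight adds less than m * w * p + w to
    it, for a total of w * (s + p * m + 1). *)
Lemma size_constraint v i : (size (constraint v i) <= B)%N.
Proof.
apply: (leq_trans (size_sum _ _ _)); apply/bigmax_leqP => k _.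
apply: (leq_trans (size_polyMleq _ _)).
have szb : (size (block v k)^`N(i) <= E)%N.
  rewrite (leq_trans (size_poly _ _)) // leq_subLR (leq_trans (size_poly _ _)) //.
  exact: leq_addl.
have szw := size_weight_poly k.
have kp : (k %% p <= p)%N by rewrite ltnW // ltn_mod.
have kw : (k %/ p < w)%N by rewrite ltn_divLR.
have le1 : (m * w * (k %% p) <= m * w * p)%N by rewrite leq_mul2l kp orbT.
move: szb szw le1 kw; rewrite /B /E /b.
move: (size _) (size _) (_ * _ * (k %% p))%N (k %/ p)%N => x y z t.
rewrite mulnDr mulnS; lia.
Qed.

Lemma aux_poly_exists : exists2 v, v != 0 & forall i, (i < l)%N -> constraint v i = 0.
Proof.
(* The choice l = s - b makes the number of equations w * (s^2 - b^2), always below the w * s^2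
   unknowns. *)
have lt_dim : (l * B < N * E)%N.
  rewrite /N -sE /l /B /E.
  have [le_sb|lt_bs] := leqP s b.
    by rewrite (eqP le_sb) mul0n !muln_gt0 s_gt0 w_gt0.
  rewrite mulnCA [ltnRHS]mulnCA ltn_pmul2l //.
  by rewrite -subn_sqr [ltnRHS]mulnn ltn_subrL [X in _ && X]expn_gt0 s_gt0 expn_gt0.
have [v v0 cv] := kernel_nonzero constraint_row lt_dim.
exists v => // i lti; apply/polyP => j; rewrite coef0.
have [ltj|lej] := ltnP j B; last by rewrite nth_default ?(leq_trans (size_constraint _ _)).
move/(congr1 vec_mx): cv; rewrite mxvecK linear0 => /matrixP/(_ (Ordinal lti) (Ordinal ltj)).
by rewrite !mxE.
Qed.

Definition aux_term v (k : 'I_N) : {poly Om} :=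
  block v k * ((U ^+ s) ^+ (k %% p) * 'X^(k %/ p * Q)).

(* The sizes of the nonzero terms are distinct because size (block v k) <= E and
   m is prime to p, so the auxiliary polynomial does not vanish identically. *)
Lemma size_aux_term v k : block v k != 0 ->
  size (aux_term v k) = (size (block v k) + E * (m * (k %% p) + p * (k %/ p)))%N.
Proof.
move=> b0; rewrite /aux_term mulrA size_mulXn; last first.
  by rewrite mulf_neq0 // !expf_neq0 // -size_poly_gt0 size_trace_half.
rewrite -exprM size_proper_mul; last first.
  by rewrite mulf_neq0 ?lead_coef_eq0 // expf_neq0 // -size_poly_gt0 size_trace_half.
have -> : size (U ^+ (s * (k %% p))) = (m * w * (s * (k %% p))).+1.
  have := size_exp U (s * (k %% p)); rewrite size_trace_half /= => <-.
  by rewrite prednK // size_poly_gt0 expf_neq0 // -size_poly_gt0 size_trace_half.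
rewrite addnS /= QE /E; lia.
Qed.

Lemma aux_poly_neq0 v : v != 0 -> \sum_k aux_term v k != 0.
Proof.
move=> v0; apply: contraNneq v0 => sum0.
have block0 k : block v k = 0.
  have [//|bk] := eqVneq (block v k) 0.
  have nz (i : 'I_N) : aux_term v i != 0 -> block v i != 0.
    by apply: contraNneq => bi; rewrite /aux_term bi mul0r.
  suff inj i j : aux_term v i != 0 -> aux_term v j != 0 ->
      size (aux_term v i) = size (aux_term v j) -> i = j.
    have /eqP := sum_distinct_size_eq0 inj sum0 k.
    by rewrite -size_poly_eq0 size_aux_term // addn_eq0 size_poly_eq0 (negbTE bk).
  move=> /nz bi /nz bj; rewrite !size_aux_term // => e.
  have szb (n : 'I_N) : block v n != 0 -> ((size (block v n)).-1 < E)%N.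
    by rewrite -size_poly_gt0 => lt0; rewrite prednK // size_poly.
  (* A nonzero block has size between 1 and E, so Euclidean division by E of the size minus one
     isolates the second summand. *)
  have {}e : ((m * (i %% p) + p * (i %/ p)) = (m * (j %% p) + p * (j %/ p)))%N.
    have /(congr1 (divn^~ E)) : ((m * (i %% p) + p * (i %/ p)) * E + (size (block v i)).-1
        = (m * (j %% p) + p * (j %/ p)) * E + (size (block v j)).-1)%N.
      apply: succn_inj; rewrite -!addnS !prednK ?size_poly_gt0 //.
      by rewrite addnC mulnC e addnC mulnC.
    by rewrite !divnMDl // !(divn_small (szb _ _)) // !addn0.
  have eqm : (i %% p = j %% p)%N.
    have : (m * i == m * j %[mod p])%N.
      move/(congr1 (modn^~ p)): e; rewrite !(mulnC p) !(addnC (m * _)%N) !modnMDl !modnMmr.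
      by move=> ->.
    by move/(eqn_mod_coprimeMl co_pm).
  apply: val_inj; rewrite /= (divn_eq i p) (divn_eq j p) eqm; congr (_ * _ + _)%N.
  by apply/eqP; rewrite -(eqn_pmul2l p_gt0) -(eqn_add2l (m * (j %% p))) -{1}eqm e.
rewrite -(vec_mxK v) (_ : vec_mx v = 0) ?linear0 //.
apply/row_matrixP => k; rewrite row0; apply: (can_inj (@rVpolyK _ _)).
by rewrite linear0; exact: block0.
Qed.

Definition trace_fibre : seq Om :=
  [seq x <- fixpts p Om (h.+1 + h.+1) | frob_trace iota g (h.+1 + h.+1) x == a].

(** The second half of the conjugates in the trace is the image of the first half under the power s,
    so the trace of g(x) is U(x) + U(x)^s. *)
Lemma mem_trace_fibre x : x \in trace_fibre ->
  x ^+ Q = x /\ U.[x] ^+ s = iota a - U.[x].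
Proof.
have eQ : Q = (p ^ (h.+1 + h.+1))%N by rewrite expnD.
rewrite mem_filter (mem_fixpts p_pr) // -eQ => /andP[/eqP tr /eqP fx]; split=> //.
have UE y : U.[y] = \sum_(i < h.+1) G.[y ^+ (p ^ i)].
  rewrite /U horner_sum; apply: eq_bigr => i _.
  by rewrite hornerE (horner_frob p_pr).
move/(congr1 iota): tr; rewrite /frob_trace (resK p_pr).
  rewrite big_split_ord /= -UE => <-; rewrite addrC addrK UE /s.
  rewrite (pow_frob_sum p_pr iota); apply: eq_bigr => i _.
  by rewrite (horner_frob p_pr) pow_frobA addnC.
have frob1 F : (\sum_(i < (h.+1 + h.+1)) F i) ^+ p =
    \sum_(i < (h.+1 + h.+1)) (F i : Om) ^+ p.
  by have := pow_frob_sum p_pr iota 1; rewrite expn1; apply.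
have horner1 y : G.[y] ^+ p = G.[y ^+ p].
  by have := horner_frob p_pr iota 1 g y; rewrite expn1.
rewrite frob1 addSn big_ord_recr [RHS]big_ord_recl addrC; congr (_ + _).
  by apply: eq_bigr => i _; rewrite horner1 -exprM -expnSr.
by rewrite horner1 -exprM -expnSr /= -addSn -eQ fx expn0 expr1.
Qed.

Lemma poly_frobB k (A A' : {poly Om}) :
  (A - A') ^+ (p ^ k) = A ^+ (p ^ k) - A' ^+ (p ^ k).
Proof.
apply: (addIr (A' ^+ (p ^ k))); rewrite subrK -exprDn_pchar ?subrK // pnatX.
by rewrite pnatE // (rmorph_pchar (@polyC Om)) ?(pchar_closure p_pr iota).
Qed.

(** Each point of the fibre is a zero of order l of the auxiliary polynomial, whose size is at most
    E * (1 + m * p + w * p) = E * (s + b). *)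
Lemma trace_fibre_bound : (size trace_fibre * l < E * (s + b))%N.
Proof.
have [v v0 cv] := aux_poly_exists.
have uZ : uniq trace_fibre by rewrite filter_uniq ?uniq_fixpts.
apply: leq_trans (size_dvd_multiplicity (l := l) uZ (aux_poly_neq0 v0) _) _; last first.
  apply: (leq_trans (size_sum _ _ _)); apply/bigmax_leqP => k _.
  have [b0|b0] := eqVneq (block v k) 0; first by rewrite /aux_term b0 mul0r size_poly0.
  have szb : (size (block v k) <= E)%N by exact: size_poly.
  have kp : (k %% p <= p)%N by rewrite ltnW // ltn_mod.
  have kw : (k %/ p < w)%N by rewrite ltn_divLR.
  rewrite size_aux_term // (leq_trans (leq_add szb (leqnn _))) //.
  rewrite -mulnS leq_mul2l; apply/orP; right; rewrite /b sE addnS ltnS.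
  by rewrite addnC leq_add // ?[(p * _)%N]mulnC ?leq_mul2r ?(ltnW kw) ?orbT // leq_mul.
move=> x /mem_trace_fibre[fx Ux].
pose W k := (iota a - U.[x]) ^+ (k %% p) * x ^+ (k %/ p).
(* K is the auxiliary polynomial with [U ^+ s] and ['X^Q] frozen at their values at x. Its Hasse
   derivatives fall on the blocks alone, so at x they are the values of the constraints. *)
pose K := \sum_k block v k * (W k)%:P.
have dvdK : ('X - x%:P) ^+ l %| K.
  apply: dvdp_nderivn => i lti; have /(congr1 (horner^~ x)) := cv i lti.
  rewrite horner0 => <-; rewrite /K /constraint linear_sum /= !horner_sum.
  apply: eq_bigr => k _; rewrite mulrC mul_polyC nderivnZ hornerZ hornerM mulrC.
  by rewrite /weight_poly !hornerE.
(* Freezing is harmless modulo the power l: A^s - A(x)^s = (A - A(x))^s is divisible by the power s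
   of 'X - x, and l <= s. *)
rewrite -[\sum__ _](subrK K) dvdp_add // /K -sumrB.
apply: (big_ind (dvdp (('X - x%:P) ^+ l))) => [|u u' du du'|k _].
- exact: dvdp0.
- exact: dvdp_add.
apply: congrpM; first by rewrite subrr dvdp0.
rewrite /W polyCM !polyC_exp mulnC exprM -Ux.
have le_ls : (l <= s)%N by exact: leq_subr.
apply: congrpM; apply: congrpX.
  rewrite polyC_exp -poly_frobB (dvdp_trans (dvdp_exp2l _ le_ls)) // dvdp_exp2r //.
  by rewrite dvdp_XsubCl /root !hornerE subrr.
rewrite -[X in _ %| _ - X%:P]fx polyC_exp /Q /s -expnD -poly_frobB dvdp_exp2l //.
by rewrite (leq_trans le_ls) // expnD leq_pmulr.
Qed.
End Stepanov.

(** * Weil's bound *)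

Section Growth.
Variable C : numClosedFieldType.
Hypothesis archiC : forall x : C, 0 <= x -> exists n : nat, x < n%:R.

Lemma bernoulli_ge (e : C) n : 0 <= e -> 1 + e *+ n <= (1 + e) ^+ n.
Proof.
move=> e0; elim: n => [|n IHn]; first by rewrite mulr0n addr0 expr0.
rewrite exprS; apply: le_trans (ler_wpM2l _ IHn); last by rewrite addr_ge0.
rewrite mulrDl mul1r mulrDr mulr1 mulrSr addrA lerD2l lerDl.
by rewrite mulr_ge0 ?mulrn_wge0.
Qed.

(** If B < x, Bernoulli's inequality makes (x / B)^h grow at least linearly in h, against the
    constant bound K / c. *)
Lemma growth_le (x B c K : C) h0 : 0 <= x -> 0 < B -> 0 < c ->
  (forall h, (h0 <= h)%N -> c * x ^+ h <= K * B ^+ h) -> x <= B.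
Proof.
move=> x0 B0 c0 bnd; have [//|ltBx] := real_leP (ger0_real x0) (gtr0_real B0).
pose e := x / B - 1.
have e0 : 0 < e by rewrite subr_gt0 ltr_pdivlMr // mul1r.
have bnd' h : (h0 <= h)%N -> c * e * h%:R <= K.
  move=> /bnd le; have : c * (1 + e) ^+ h <= K.
    by rewrite subrKC expr_div_n mulrA ler_pdivrMr // exprn_gt0.
  apply: le_trans; rewrite -mulrA ler_pM2l // mulr_natr.
  by apply: le_trans (bernoulli_ge _ (ltW e0)); rewrite lerDr ler01.
have ce0 : 0 < c * e by rewrite mulr_gt0.
have K0 : 0 <= K by apply: le_trans (bnd' h0 (leqnn _)); rewrite mulr_ge0 // ltW.
have [n ltn] := archiC (divr_ge0 K0 (ltW ce0)).
have := bnd' (maxn h0 n) (leq_maxl _ _).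
rewrite mulrC -ler_pdivlMr // => le.
have := lt_le_trans ltn (_ : n%:R <= (maxn h0 n)%:R).
by rewrite ler_nat leq_maxr => /(_ isT) /lt_le_trans/(_ le); rewrite ltxx.
Qed.

(* The polynomial q kills all terms of the power sums but those of x. *)
Lemma power_sum_growth (s : seq C) (B K : C) h0 : 0 < B ->
  (forall h, (h0 <= h)%N -> `|power_sum s h| <= K * B ^+ h) ->
  {in s, forall x, `|x| <= B}.
Proof.
move=> B0 bnd x xs; pose q := \prod_(y <- undup s | y != x) ('X - y%:P).
have filter h : \sum_(k < size q) q`_k * power_sum s (h + k)
    = x ^+ h * q.[x] *+ count_mem x s.
  transitivity (\sum_(y <- s) y ^+ h * q.[y]).
    rewrite /power_sum; under eq_bigr do rewrite mulr_sumr.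
    rewrite exchange_big; apply: eq_bigr => y _.
    rewrite horner_coef mulr_sumr; apply: eq_bigr => k _.
    by rewrite exprD mulrCA.
  rewrite (bigID (pred1 x)) /= [X in _ + X]big1_seq ?addr0.
    rewrite -big_filter (eq_big_seq (fun _ => x ^+ h * q.[x])).
      by rewrite big_const_seq count_predT size_filter iter_addr addr0.
    by move=> y; rewrite mem_filter => /andP[/eqP->].
  move=> y /andP[neq ys]; rewrite /q.
  suff -> : (\prod_(y <- undup s | y != x) ('X - y%:P)).[y] = 0 by rewrite mulr0.
  apply/rootP; rewrite -big_filter root_prod_XsubC mem_filter neq mem_undup.
  exact: ys.
have qx : q.[x] != 0.
  rewrite -[_ != 0]/(~~ root q x) /q -big_filter root_prod_XsubC mem_filter eqxx.
  by [].
pose K' := \sum_(k < size q) `|q`_k| * (K * B ^+ k).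
apply: (growth_le (c := `|q.[x]|) (K := K') (h0 := h0)); rewrite ?normr_gt0 //.
move=> h le_h.
have cnt : (0 < count_mem x s)%N by rewrite -has_count has_pred1.
apply: (@le_trans _ _ `|x ^+ h * q.[x] *+ count_mem x s|).
  rewrite normrMn normrM normrX mulrC -mulr_natl.
  by rewrite ler_peMl ?ler1n ?mulr_ge0 ?exprn_ge0.
rewrite -filter; apply: (le_trans (ler_norm_sum _ _ _)).
rewrite mulr_suml; apply: ler_sum => k _; rewrite normrM -mulrA ler_wpM2l //.
apply: (le_trans (bnd _ _)); first by rewrite (leq_trans le_h) // leq_addr.
by rewrite exprD -mulrA [B ^+ k * _]mulrC.
Qed.
End Growth.

Section Weil.
Variables (p : nat) (p_pr : prime p) (C : numClosedFieldType).
Hypothesis archiC : forall x : C, 0 <= x -> exists n : nat, x < n%:R.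
Variable psi : 'F_p -> C.
Hypotheses (psi0 : psi 0 = 1) (psiD : {morph psi : a b / a + b >-> a * b}).
Hypotheses (psi_nontrivial : psi 1 != 1) (psi_norm : forall a, `|psi a| = 1).
Variable g : {poly 'F_p}.
Let m := (size g).-1.
Hypotheses (m_gt0 : (0 < m)%N) (co_pm : coprime p m).
Variables (Om : closedFieldType) (iota : {rmorphism 'F_p -> Om}).

Local Notation char_sum := (char_sum iota psi g).
Local Notation Lcoef := (Lcoef iota psi g).

Lemma sum_psi : \sum_a psi a = 0.
Proof.
have e : \sum_a psi a = psi 1 * \sum_a psi a.
  rewrite mulr_sumr {1}(reindex_inj (addrI 1)) /=.
  by apply: eq_bigr => a _; rewrite psiD.
move/eqP: e; rewrite -[X in X == _]mul1r -subr_eq0 -mulrBl mulf_eq0 subr_eq0.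
by rewrite [1 == _]eq_sym (negbTE psi_nontrivial) => /eqP.
Qed.

(* The fibre sizes N a are at most E + kap with average E, hence the sum of the
   |N a - E| is at most the sum of the 2 kap - (N a - E), that is 2 p kap. *)
Lemma char_sum_even h : (2 * (p * m).+1 <= p ^ h.+1)%N ->
  `|char_sum (h.+1 + h.+1)| <= (8 * (p * m).+1 * p ^ h.+1)%:R.
Proof.
move=> le_b; set b := (p * m).+1 in le_b *; set s := (p ^ h.+1)%N in le_b *.
set w := (p ^ h)%N; have sE : s = (w * p)%N by rewrite /s expnSr.
pose N a := size (trace_fibre iota g a h).
have le_N a : (N a <= w * s + 4 * b * w)%N.
  have := trace_fibre_bound p_pr iota a h m_gt0 co_pm.
  rewrite -/m -/b -/s -/w -/(N a) => bnd; rewrite leqNgt; apply/negP => lt.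
  (* After removing w, s * (s + b) <= (s + 4 * b) * (s - b) amounts to 2 * b <= s, which is the
     hypothesis [le_b]. *)
  have : (w * s * (s + b) <= (w * s + 4 * b * w) * (s - b))%N.
    rewrite (_ : w * s + 4 * b * w = w * (s + 4 * b))%N; last by lia.
    rewrite -!mulnA leq_mul2l; apply/orP; right.
    have [t et le_bt] : exists2 t, s = (t + b)%N & (b <= t)%N by exists (s - b)%N; lia.
    have le_bbt : (b * b <= b * t)%N by rewrite leq_mul2l le_bt orbT.
    by rewrite et addnK !mulnDl !mulnDr; lia.
  have : ((w * s + 4 * b * w) * (s - b) <= N a * (s - b))%N.
    by rewrite leq_mul2r ltnW ?orbT.
  lia.
have sumN : (\sum_a N a = p * (w * s))%N.
  rewrite mulnA [(p * w)%N]mulnC -sE -expnD -(size_fixpts p_pr Om) //.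
  rewrite -sum1_size (partition_big (frob_trace iota g (h.+1 + h.+1)) xpredT) //=.
  by apply: eq_bigr => a _; rewrite -big_filter sum1_size.
(* Subtracting the average fibre size changes nothing because [psi] sums to 0. *)
have SE : char_sum (h.+1 + h.+1) = \sum_a ((N a)%:R - (w * s)%:R) * psi a.
  under eq_bigr do rewrite mulrBl.
  rewrite sumrB -mulr_sumr sum_psi mulr0 subr0 /char_sum.
  rewrite (partition_big (frob_trace iota g (h.+1 + h.+1)) xpredT) //=.
  apply: eq_bigr => a _; rewrite (eq_bigr (fun _ => psi a)) => [|x /eqP->] //.
  by rewrite -big_filter big_const_seq count_predT iter_addr addr0 mulr_natl.
rewrite SE; apply: (le_trans (ler_norm_sum _ _ _)).
pose kap := (4 * b * w)%:R : C.
apply: (@le_trans _ _ (\sum_a (kap *+ 2 - ((N a)%:R - (w * s)%:R)))).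
  apply: ler_sum => a _; rewrite normrM psi_norm mulr1.
  have le1 : (N a)%:R - (w * s)%:R <= kap by rewrite lerBlDl -natrD ler_nat.
  have kap0 : 0 <= kap by exact: ler0n.
  case: (real_ge0P (_ : (N a)%:R - (w * s)%:R \is Num.real)) => [|ge0|lt0].
  - by rewrite rpredB ?realn.
  - by rewrite lerBrDl -mulr2n lerMn2r.
  - by rewrite lerDr mulrn_wge0.
rewrite sumrB sumr_const card_Fp // sumrB sumr_const card_Fp //.
rewrite -natr_sum sumN.
have -> : (w * s)%:R *+ p = (p * (w * s))%:R :> C by rewrite (mulnC p) -mulr_natr -natrM.
by rewrite subrr subr0 /kap -!mulrnA ler_nat sE; lia.
Qed.

(** [La] is the L-polynomial reversed, monic because [Lcoef 0] is 1, so its roots [om] satisfy L =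
    [revprod om]. The recurrence of [Lcoef] and Newton's identities are then one recursion, which
    determines S_r and minus the power sums alike. *)
Lemma Lroots_exist : exists2 om : seq C, size om = m.-1 &
  forall r, (0 < r)%N -> char_sum r = - power_sum om r.
Proof.
have szg : size g = m.+1 by move: m_gt0; rewrite /m; case: (size g).
have mN0 : m%:R != 0 :> 'F_p.
  by rewrite -(dvdn_pcharf (pchar_Fp p_pr)) -prime_coprime.
have L0 n : (m <= n)%N -> Lcoef n = 0.
  by move=> le; apply: Lcoef_eq0 => //; rewrite szg ltnS m_gt0 ltnS le.
pose La : {poly C} := \poly_(i < m) Lcoef (m.-1 - i).
have szLa : size La = m.
  by rewrite size_poly_eq // subnn Lcoef0 // oner_eq0.
have mLa : La \is monic.
  by rewrite monicE lead_coefE szLa coef_poly prednK // leqnn subnn Lcoef0.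
have [om eLa] := closed_field_poly_normal La.
rewrite (monicP mLa) scale1r in eLa.
have szom : size om = m.-1 by move: szLa; rewrite eLa size_prod_XsubC => <-.
exists om => //.
have revE j : (revprod om)`_j = Lcoef j.
  have [ltjm|lemj] := ltnP j m.
    have lej : (j <= m.-1)%N by rewrite -ltnS prednK.
    rewrite -coef_prod_XsubC ?szom // -eLa coef_poly.
    by rewrite (leq_ltn_trans (leq_subr _ _)) ?prednK // subKn.
  by rewrite coef_revprod_gt ?L0 // szom prednK.
elim/ltn_ind => -[//|r] IHr _.
have := newton_identity om r.+1; rewrite !revE Lcoef_recurrence //.
rewrite big_add1 /= big_mkord !big_ord_recr /= subnn coef0_revprod Lcoef0 // mulr1 mul1r.
rewrite opprD -sumrN (eq_bigr (fun i : 'I_r =>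
  - ((revprod om)`_(r.+1 - i.+1) * power_sum om i.+1))); first exact: addrI.
by move=> i _; rewrite IHr // ?ltnS // revE mulNr mulrC.
Qed.

(** Only S_r with r even has been estimated, so the growth argument is applied to the squares of the
    [om], with p in place of its square root. The threshold [h0] ensures 2 * b <= p^h. *)
Lemma weil_bound_aux : `|char_sum 1| <= m.-1%:R * sqrtC p%:R.
Proof.
have [om szom SE] := Lroots_exist.
have p0 : 0 < p%:R :> C by rewrite ltr0n prime_gt0.
have sq_le : {in [seq x ^+ 2 | x <- om], forall y, `|y| <= p%:R}.
  pose b := (p * m).+1.
  apply: (power_sum_growth archiC (K := (8 * b)%:R) (h0 := (2 * b).+1)) => //.
  case=> [//|h] le_h.
  have -> : power_sum [seq x ^+ 2 | x <- om] h.+1 = - char_sum (h.+1 + h.+1).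
    rewrite SE // opprK /power_sum big_map; apply: eq_bigr => x _.
    by rewrite -exprM mul2n addnn.
  rewrite normrN -natrX -natrM; apply: char_sum_even.
  by rewrite (leq_trans (ltnW le_h)) // ltnW // ltn_expl // prime_gt1.
rewrite SE // normrN /power_sum; apply: (le_trans (ler_norm_sum _ _ _)).
rewrite -szom -sum1_size natr_sum mulr_suml big_seq [leRHS]big_seq.
apply: ler_sum => x xom; rewrite mul1r expr1 -(ler_pXn2r (n := 2)) ?nnegrE ?sqrtC_ge0 ?ler0n //.
by rewrite sqrtCK -normrX; exact: (sq_le _ (map_f (fun x => x ^+ 2) xom)).
Qed.
End Weil.

Lemma weil_bound p (p_pr : prime p) (C : numClosedFieldType) (psi : 'F_p -> C)
    (g : {poly 'F_p}) :
  (forall x : C, 0 <= x -> exists n : nat, x < n%:R) ->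
  psi 0 = 1 -> {morph psi : a b / a + b >-> a * b} -> psi 1 != 1 ->
  (forall a, `|psi a| = 1) -> (0 < (size g).-1)%N -> coprime p (size g).-1 ->
  `|\sum_a psi g.[a]| <= (size g).-2%:R * sqrtC p%:R.
Proof.
move=> archiC psi0 psiD psi1 psi_norm m_gt0 co_pm.
have [Om [iota _]] := countable_algebraic_closure 'F_p.
have := @weil_bound_aux p p_pr C archiC psi psi0 psiD psi1 psi_norm g m_gt0 co_pm Om iota.
congr (`|_| <= _); rewrite /char_sum.
have ui : uniq [seq iota a | a <- enum 'F_p].
  by rewrite map_inj_uniq ?enum_uniq //; exact: fmorph_inj.
have usub : {subset [seq iota a | a <- enum 'F_p] <= fixpts p Om 1}.
  by move=> _ /mapP[a _ ->]; rewrite mem_fixpts // frob_iota.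
have [|_ eqi] := uniq_min_size ui usub.
  by rewrite size_fixpts // size_map -cardE card_Fp.
rewrite -(perm_big _ (uniq_perm ui (uniq_fixpts p_pr iota _) eqi)) // big_map.
rewrite big_enum; apply: eq_bigr => a _; congr psi.
by rewrite /frob_trace big_ord1 expn0 expr1 horner_map iotaK.
Qed.

(** * Exponential sums over a single prime *)

Section AdditiveCharacters.
Variable R : realType.
Local Open Scope complex_scope.
Local Notation normc := (@Normc.normc R).
Implicit Types (s t : R) (z : R[i]).

Lemma normc_norm z : `|z| = (normc z)%:C.
Proof. by case: z. Qed.

Lemma normc_ge0 z : 0 <= normc z.
Proof. by rewrite -lecR -normc_norm; exact: normr_ge0. Qed.

Lemma normc_natr n : normc n%:R = n%:R.
Proof. by apply: complexI; rewrite -normc_norm normr_nat rmorph_nat. Qed.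

Lemma normc_sum (I : Type) (r : seq I) (P : pred I) (F : I -> R[i]) :
  normc (\sum_(i <- r | P i) F i) <= \sum_(i <- r | P i) normc (F i).
Proof.
apply: (big_rec2 (fun u v => normc u <= v)) => [|i u v _ le]; first by rewrite Normc.normc0.
by apply: (le_trans (le_normcD _ _)); rewrite lerD2l.
Qed.

Lemma Re_le_normc z : `|complex.Re z| <= normc z.
Proof. by rewrite -lecR -normc_norm; exact: normc_ge_Re. Qed.

Lemma expi2piD s t : expi2pi (s + t) = expi2pi s * expi2pi t.
Proof.
rewrite /expi2pi mulrDr cosD sinD; apply/eqP; rewrite eq_complex /=.
by rewrite eqxx /= addrC [X in _ + X]mulrC [X in X + _]mulrC addrC eqxx.
Qed.

Lemma expi2pi0 : expi2pi (0 : R) = 1.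
Proof. by rewrite /expi2pi mulr0 cos0 sin0. Qed.

Lemma expi2pi1 : expi2pi (1 : R) = 1.
Proof. by rewrite /expi2pi mulr1 mulrC mulr_natr cos2pi sin2pi. Qed.

Lemma normc_expi2pi t : normc (expi2pi t) = 1.
Proof. by rewrite /expi2pi /= cos2Dsin2 sqrtr1. Qed.

Lemma expi2piN t : expi2pi (- t) = (expi2pi t)^-1.
Proof.
have nz : expi2pi t != 0.
  apply/eqP => /(congr1 normc); rewrite normc_expi2pi Normc.normc0.
  by move/eqP; rewrite oner_eq0.
apply: (mulIf (x := expi2pi t)).
  exact: nz.
by rewrite -expi2piD addNr expi2pi0 mulVf.
Qed.

Lemma expi2pi_nat n : expi2pi (n%:R : R) = 1.
Proof.
by elim: n => [|n IHn]; rewrite ?expi2pi0 // mulrSr expi2piD IHn expi2pi1 mulr1.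
Qed.

Lemma expi2pi_int (k : int) : expi2pi (k%:~R : R) = 1.
Proof.
case: (intP k) => [|n|n]; rewrite ?expi2pi0 ?expi2pi_nat //.
by rewrite rmorphN /= expi2piN expi2pi_nat invr1.
Qed.

Lemma expi2pi_neq1 t : 0 < t < 1 -> expi2pi t != 1.
Proof.
move=> /andP[t0 t1]; apply/eqP => /(congr1 (@complex.Re R)) /=.
(* By the double angle formula, cos (2 pi t) = 1 would force sin (pi t) = 0, impossible for 0 < t <
   1. *)
rewrite -mulrA -[2]/(1 + 1) mulrDl mul1r cosD -!expr2 => e.
have : sin (pi * t) != 0.
  by rewrite gt_eqF // sin_gt0_pi // mulr_gt0 ?pi_gt0 //= gtr_pMr ?pi_gt0.
move: e; rewrite -(cos2Dsin2 (pi * t)) => /addrI/eqP.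
rewrite eq_sym -subr_eq0 opprK -mulr2n -mulr_natr mulf_eq0 pnatr_eq0 orbF.
by rewrite expf_eq0 /= => /eqP->; rewrite eqxx.
Qed.

Definition ep (q : nat) (k : int) : R[i] := expi2pi (k%:~R / q%:R).

Lemma epD q : {morph ep q : k l / k + l >-> k * l}.
Proof. by move=> k l; rewrite /ep rmorphD mulrDl expi2piD. Qed.

Lemma ep0 q : ep q 0 = 1.
Proof. by rewrite /ep mul0r expi2pi0. Qed.

Lemma normc_ep q k : normc (ep q k) = 1.
Proof. exact: normc_expi2pi. Qed.

Lemma normc_sum_ep q n (F : nat -> int) :
  normc (\sum_(0 <= i < n) ep q (F i)) <= n%:R.
Proof.
apply: (le_trans (normc_sum _ _ _)).
under eq_bigr do rewrite normc_ep.
by rewrite big_const_nat subn0 iter_addr addr0.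
Qed.

Lemma ep_mulq q k : (0 < q)%N -> ep q (k * q%:Z) = 1.
Proof.
by move=> q0; rewrite /ep rmorphM /= mulfK ?expi2pi_int // pnatr_eq0 -lt0n.
Qed.

Lemma ep_cancel q1 q2 k : (0 < q2)%N -> ep (q1 * q2) (k * q2%:Z) = ep q1 k.
Proof.
move=> q0; rewrite /ep rmorphM natrM /= -mulf_div divff ?mulr1 //.
by rewrite pnatr_eq0 -lt0n.
Qed.

Lemma ep_modn q n : (0 < q)%N -> ep q (n %% q)%N = ep q n.
Proof.
by move=> q0; rewrite [in RHS](divn_eq n q) PoszD PoszM epD ep_mulq ?mul1r.
Qed.

Section Prime.
Variables (p : nat) (p_pr : prime p).
Let p_gt0 := prime_gt0 p_pr.

Definition psi (a : 'F_p) : R[i] := ep p (a : nat).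

Lemma psi0 : psi 0 = 1.
Proof. exact: ep0. Qed.

Lemma psiD : {morph psi : a b / a + b >-> a * b}.
Proof.
move=> a b; rewrite /psi -epD -PoszD /=.
by move: (nat_of_ord a) (nat_of_ord b) => u v; rewrite Fp_cast // ep_modn.
Qed.

Lemma psi1 : psi 1 = ep p 1.
Proof. by []. Qed.

Lemma psi1_neq1 : psi 1 != 1.
Proof.
rewrite psi1 /ep mul1r expi2pi_neq1 // invr_gt0 ltr0n p_gt0 /=.
by rewrite invf_lt1 ?ltr0n // ltr1n prime_gt1.
Qed.

Lemma psi_intr (k : int) : psi k%:~R = ep p k.
Proof.
have psi_nat n : psi n%:R = ep p n.
  elim: n => [|n IHn]; first by rewrite psi0 ep0.
  by rewrite mulrSr psiD IHn -addn1 PoszD epD psi1.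
case: (intP k) => [|n|n]; rewrite ?psi0 ?ep0 ?psi_nat //.
have u : psi n.+1%:R * psi (- n.+1%:R) = 1 by rewrite -psiD subrr psi0.
have v : ep p n.+1 * ep p (- n.+1%:Z) = 1 by rewrite -epD subrr ep0.
have n0 : ep p n.+1 != 0.
  by apply: contra_eq_neq v => ->; rewrite mul0r eq_sym oner_eq0.
by apply: (mulfI n0); rewrite v -psi_nat rmorphN.
Qed.

Lemma big_Fp (F : 'F_p -> R[i]) : \sum_a F a = \sum_(0 <= n < p) F n%:R.
Proof.
transitivity (\sum_(0 <= n < (Zp_trunc (pdiv p)).+2) F n%:R).
  by rewrite big_mkord; apply: eq_bigr => a _; rewrite natr_Zp.
by congr (\sum_(0 <= n < _) _); exact: Fp_cast.
Qed.

Lemma sum_psiM (c : 'F_p) : \sum_a psi (a * c) = p%:R *+ (c == 0).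
Proof.
have [->|c0] := eqVneq c 0.
  under eq_bigr do rewrite mulr0 psi0.
  by rewrite sumr_const card_Fp // mulr1n.
rewrite mulr0n -[RHS](sum_psi psiD psi1_neq1) (reindex_inj (mulIf (x := c^-1) _)).
  by apply: eq_bigr => a _; rewrite divfK.
by rewrite invr_eq0.
Qed.

Lemma sum_ep_mul (c : int) :
  \sum_(0 <= n < p) ep p (n%:Z * c) = p%:R *+ (c%:~R == 0 :> 'F_p).
Proof.
rewrite -sum_psiM big_Fp; apply: eq_bigr => n _.
by rewrite -psi_intr rmorphM.
Qed.

Lemma archi_complex (x : R[i]) : 0 <= x -> exists n : nat, x < n%:R.
Proof.
move=> x0; exists (Num.bound (complex.Re x)).
rewrite -[x]RRe_real ?ger0_real // -(rmorph_nat (real_complex R)) ltcR.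
by apply: archi_boundP; move: x0; rewrite lecE /= => /andP[].
Qed.

Lemma weil_bound_normc (g : {poly 'F_p}) : (0 < (size g).-1)%N ->
  coprime p (size g).-1 ->
  normc (\sum_a psi g.[a]) <= (size g).-2%:R * Num.sqrt p%:R.
Proof.
move=> m_gt0 co_pm.
have psi_norm a : `|psi a| = 1 by rewrite normc_norm normc_ep.
have := weil_bound p_pr archi_complex psi0 psiD psi1_neq1 psi_norm m_gt0 co_pm.
rewrite normc_norm => le.
suff e : sqrtC p%:R = (Num.sqrt p%:R)%:C :> R[i].
  by move: le; rewrite e -(rmorph_nat (real_complex R)) -rmorphM lecR.
apply/eqP; rewrite -(eqrXn2 (n := 2)) ?sqrtC_ge0 ?ler0n ?ler0c ?sqrtr_ge0 //.
by rewrite sqrtCK -rmorphXn /= sqr_sqrtr ?ler0n // rmorph_nat.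
Qed.
End Prime.
End AdditiveCharacters.

Lemma sum_nat_mul (V : nmodType) (F : nat -> V) q c :
  \sum_(0 <= n < c * q) F n = \sum_(0 <= b < c) \sum_(0 <= a < q) F (a + b * q)%N.
Proof.
elim: c => [|c IHc]; first by rewrite mul0n !big_geq.
rewrite big_nat_recr //= -IHc mulSnr (big_cat_nat (n := c * q)) ?leq_addr //=.
congr (_ + _); rewrite -[X in \sum_(X <= _ < _) _]add0n big_addn.
by rewrite addKn.
Qed.

Lemma horner_taylor2 (A : comNzRingType) (P : {poly A}) (x : A) :
  forall h, exists e, P.[x + h] = P.[x] + P^`().[x] * h + e * h ^+ 2.
Proof.
move=> h; elim/poly_ind: P => [|P c [e IHP]].
  by exists 0; rewrite deriv0 !horner0 !mul0r !addr0.
exists (P^`().[x] + e * (x + h)); rewrite derivMXaddC !hornerE IHP.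
by rewrite /=; ring.
Qed.

Section KorobovSums.
Variables (R : realType) (d : nat) (k : d.-tuple int).
Local Notation normc := (@Normc.normc R).

(** This is k_1 X + ... + k_d X^d. Lacking a constant term, it is nonconstant modulo p as soon as p
    does not divide all the k_j. *)
Definition phase : {poly int} := Poly k * 'X.

Lemma coef_phaseS j : phase`_j.+1 = nth 0 k j.
Proof. by rewrite coefMX /= coef_Poly. Qed.

Lemma size_phase : (size phase <= d.+1)%N.
Proof.
apply: (leq_trans (size_polyMleq _ _)); rewrite size_polyX addn2 /= ltnS.
by rewrite (leq_trans (size_Poly _)) // size_tuple.
Qed.

Lemma phaseE (n : int) : phase.[n] = \sum_(j < d) tnth k j * n ^+ j.+1.
Proof.
rewrite (horner_coef_wide _ size_phase) big_ord_recl coefMX /= mul0r add0r.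
apply: eq_bigr => j _; rewrite -[LHS]/(phase`_j.+1 * n ^+ j.+1).
by rewrite coef_phaseS -tnth_nth.
Qed.

Lemma expi2pi_dot_korobov a n q :
  expi2pi (dot k (korobov_point R d a n q)) = ep R q (a%:Z * phase.[n%:Z]).
Proof.
rewrite /dot; pose fl (j : 'I_d) := Num.floor ((a * n ^ j.+1)%:R / q%:R : R).
have -> : \sum_(j < d) (tnth k j)%:~R * (tnth (korobov_point R d a n q) j : R) =
    (a%:Z * phase.[n%:Z])%:~R / q%:R + (- \sum_(j < d) tnth k j * fl j)%:~R.
  rewrite phaseE mulr_sumr rmorphN !rmorph_sum /= mulr_suml -sumrB.
  apply: eq_bigr => j _; rewrite tnth_mktuple /Defs.frac -/(fl j) natrM natrX.
  by rewrite !rmorphM /= rmorphXn /= -!pmulrn; ring.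
by rewrite expi2piD expi2pi_int mulr1.
Qed.

Section OnePrime.
Variables (p : nat) (p_pr : prime p).
Let p_gt0 := prime_gt0 p_pr.

Definition dvd_coefs : bool := [forall j, (p %| tnth k j)%Z].

Let g : {poly 'F_p} := map_poly intr phase.

Lemma intr_Fp_eq0 (z : int) : (z%:~R == 0 :> 'F_p) = (p %| z)%Z.
Proof. by rewrite -(dvdz_pcharf (pchar_Fp p_pr)). Qed.

Lemma horner_phase_Fp (z : int) : g.[z%:~R] = (phase.[z])%:~R.
Proof. exact: horner_map. Qed.

Hypothesis ndvd : ~~ dvd_coefs.

Lemma coef_phase_neq0 : exists2 j, (j < d)%N & g`_j.+1 != 0.
Proof.
move: ndvd; rewrite negb_forall => /existsP[j]; rewrite -intr_Fp_eq0 => nz.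
by exists j => //; rewrite coef_map coef_phaseS -tnth_nth.
Qed.

Lemma size_phase_Fp : (1 < size g <= d.+1)%N.
Proof.
have [j _ nz] := coef_phase_neq0; apply/andP; split.
  rewrite ltnNge; apply: contra nz => le; rewrite nth_default //.
  exact: leq_trans le _.
exact: (leq_trans (size_poly _ _) size_phase).
Qed.

Lemma count_roots_le (h : {poly 'F_p}) n : h != 0 -> (size h <= n.+1)%N ->
  (\sum_(0 <= a < p) (h.[a%:R] == 0 :> 'F_p)%R <= n)%N.
Proof.
move=> h0 szh; pose rs := [seq a <- [seq (i%:R : 'F_p) | i <- seq.iota 0 p] | root h a].
have urs : uniq rs.
  rewrite filter_uniq // map_inj_in_uniq ?iota_uniq // => i j.
  rewrite !mem_iota /= !add0n => lti ltj /(congr1 val).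
  by rewrite /= !val_Fp_nat // !modn_small.
have : (size rs < size h)%N by apply: max_poly_roots => //; exact: filter_all.
move=> /leq_trans/(_ szh); rewrite ltnS; apply: leq_trans.
rewrite size_filter count_map -sum1_count [leqRHS]big_mkcond /index_iota subn0.
by apply: leq_sum => i _ /=; rewrite /root; case: (_ == 0).
Qed.

(** Weil's bound requires a degree prime to p, which holds when d < p. If p <= d, the trivial bound
    p <= d sqrt p suffices. *)
Lemma korobov_S_bound :
  normc (\sum_(0 <= n < p) ep R p phase.[n%:Z]) <= d%:R * Num.sqrt p%:R.
Proof.
have [le_pd|lt_dp] := leqP p d.
  apply: (le_trans (normc_sum_ep _ _ _ _)).
  rewrite -{1}(@sqr_sqrtr _ p%:R) ?ler0n // expr2 ler_wpM2r ?sqrtr_ge0 //.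
  apply: (@le_trans _ _ p%:R); last by rewrite ler_nat.
  rewrite -{2}(@sqr_sqrtr _ p%:R) ?ler0n // expr2 ler_peMr ?sqrtr_ge0 //.
  by rewrite -[leLHS]sqrtr1 ler_sqrt ?ltr01 // ler1n.
have /andP[szg szg_le] := size_phase_Fp.
have m_gt0 : (0 < (size g).-1)%N by rewrite -ltnS (ltn_predK szg).
have lemd : ((size g).-1 <= d)%N by rewrite -ltnS (ltn_predK szg).
have co : coprime p (size g).-1.
  by rewrite prime_coprime // gtnNdvd // (leq_ltn_trans lemd).
have := weil_bound_normc R p_pr m_gt0 co.
rewrite big_Fp //; under eq_bigr do rewrite -[_%:R]/((_%:Z)%:~R) horner_phase_Fp psi_intr //.
move=> /le_trans; apply; rewrite ler_wpM2r ?sqrtr_ge0 // ler_nat.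
exact: leq_trans (leq_pred _) lemd.
Qed.

(** Summing over a first, orthogonality leaves p times the number of roots of the phase modulo p. *)
Lemma korobov_U_bound :
  normc (\sum_(0 <= a < p) \sum_(0 <= n < p) ep R p (a%:Z * phase.[n%:Z])) <= (d * p)%:R.
Proof.
rewrite exchange_big /=; under eq_bigr do rewrite sum_ep_mul //.
rewrite sumrMnr -mulrnA normc_natr ler_nat mulnC leq_mul2r; apply/orP; right.
have [szg szg_le] := andP size_phase_Fp.
have g0 : g != 0 by rewrite -size_poly_gt0 ltnW.
have := count_roots_le g0 szg_le; apply: leq_trans; apply: leq_sum => n _.
by rewrite -horner_phase_Fp.
Qed.

(* Writing n = a + b * p, the phase at n is P(a) + b p P'(a) modulo p ^ 2, so the
   sum over b vanishes unless P'(a) = 0 modulo p. *)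
Lemma korobov_T_bound :
  normc (\sum_(0 <= n < p ^ 2) ep R (p ^ 2) phase.[n%:Z]) <= (d * p)%:R.
Proof.
have [le_pd|lt_dp] := leqP p d.
  apply: (le_trans (normc_sum_ep _ _ _ _)); rewrite ler_nat -mulnn.
  by rewrite leq_mul2r le_pd orbT.
(* The derivative has a coefficient (j + 1) k_j, with p not dividing k_j, and j + 1 <= d < p keeps
   it nonzero. *)
have dg0 : g^`() != 0.
  have [j ltj nz] := coef_phase_neq0.
  apply: contra_neq nz => /(congr1 (fun h : {poly 'F_p} => h`_j)).
  rewrite coef_deriv coef0 -mulr_natr => /eqP; rewrite mulf_eq0.
  rewrite -(dvdn_pcharf (pchar_Fp p_pr)) gtnNdvd ?orbF => [/eqP //|//|].
  exact: leq_ltn_trans ltj lt_dp.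
have szdg : (size g^`() <= d.+1)%N.
  have /andP[_ le] := size_phase_Fp.
  by rewrite (leq_trans (size_poly _ _)) // (leq_trans (leq_pred _)).
rewrite -mulnn sum_nat_mul exchange_big /=.
have inner a : \sum_(0 <= b < p) ep R (p * p) phase.[(a + b * p)%N%:Z]
    = ep R (p * p) phase.[a%:Z] * (p%:R *+ (g^`().[a%:R] == 0 :> 'F_p)).
  have -> : (g^`().[a%:R] == 0) = ((phase^`().[a%:Z])%:~R == 0 :> 'F_p).
    by rewrite deriv_map -[a%:R]/((a%:Z)%:~R) horner_map.
  rewrite -sum_ep_mul // mulr_sumr; apply: eq_bigr => b _.
  have [e ->] := horner_taylor2 phase a%:Z (b * p)%N%:Z.
  rewrite PoszM !epD -mulrA; congr (_ * _).
  rewrite mulrA ep_cancel // [X in _ * X](_ : _ = 1) ?mulr1 //.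
    by rewrite mulrC.
  have -> : e * (b%:Z * p%:Z) ^+ 2 = e * b%:Z ^+ 2 * (p * p)%N%:Z by rewrite PoszM; ring.
  by rewrite ep_mulq // muln_gt0 p_gt0.
under eq_bigr do rewrite inner.
apply: (le_trans (normc_sum _ _ _)).
under eq_bigr do rewrite Normc.normcM normc_ep mul1r -mulrnA normc_natr mulnC.
by rewrite -natr_sum ler_nat -big_distrl leq_mul2r (count_roots_le dg0 szdg) orbT.
Qed.
End OnePrime.
End KorobovSums.

(** * Summation over the window of primes *)

Lemma mem_window M p : p \in prime_window M -> [/\ prime p, (M < 2 * p)%N & (p <= M)%N].
Proof.
rewrite mem_filter mem_index_iota => /and3P[p_pr lt_p le_p]; split=> //.
move: lt_p; rewrite uphalf_half; have := odd_double_half M; lia.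
Qed.

Lemma uniq_window M : uniq (prime_window M).
Proof. by rewrite filter_uniq ?iota_uniq. Qed.

(** Counting all integers of the window is enough to bound the number of S-points by M^2 and that of
    T- or U-points by M^3 / 2, which converts powers of M into powers of the number of points. *)
Lemma size_window M : (2 * size (prime_window M) <= M)%N.
Proof.
have : (size (prime_window M) <= M.+1 - (uphalf M).+1)%N.
  by rewrite size_filter (leq_trans (count_size _ _)) // size_iota.
rewrite subSS uphalf_half; have := odd_double_half M; lia.
Qed.

Lemma prod_primes_dvd (s : seq nat) n : uniq s -> all prime s ->
  {in s, forall p, p %| n}%N -> (\prod_(p <- s) p %| n)%N.
Proof.
elim: s => [|p s IHs] /=; first by rewrite big_nil dvd1n.
move=> /andP[ps us] /andP[p_pr s_pr] dvd; rewrite big_cons Gauss_dvd.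
  rewrite dvd ?mem_head //= IHs // => q qs.
  by rewrite dvd // inE qs orbT.
rewrite big_seq; apply: (big_ind (coprime p)) => [|u v cu cv|q qs].
- exact: coprimen1.
- by rewrite coprimeMr cu.
rewrite prime_coprime // dvdn_prime2 //; last exact: (allP s_pr).
by apply: contraNneq ps => ->.
Qed.

Section Window.
Variables (R : realType) (c : R) (M : nat).
Hypotheses (c_gt0 : 0 < c) (c_lt1 : c < 1) (M_ge2 : (2 <= M)%N).
Let P := prime_window M.
Hypothesis hcount : c * (M%:R / ln M%:R) <= (size P)%:R.
Variables (d : nat) (k : d.-tuple int).
Hypothesis d_gt0 : (0 < d)%N.
Local Notation normc := (@Normc.normc R).

Let D := [seq p <- P | dvd_coefs k p].

Lemma size_dividing j : tnth k j != 0 ->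
  (size D)%:R * ln (M%:R : R) <= 2 * ln (`|tnth k j|%:~R).
Proof.
move=> kj0; set n := `|tnth k j|%N.
have n_gt0 : (0 < n)%N by rewrite absz_gt0.
have -> : `|tnth k j|%:~R = n%:R :> R by rewrite -abszE.
have dvdD : (\prod_(p <- D) p %| n)%N.
  apply: prod_primes_dvd; first by rewrite filter_uniq ?uniq_window.
    by apply/allP => p; rewrite mem_filter => /andP[_ /mem_window[]].
  by move=> p; rewrite mem_filter => /andP[/forallP/(_ j)].
(* From M < 2 * p and 2 <= p follows M <= p^2, the origin of the factor 2. *)
have le_prod : (M ^ size D <= (\prod_(p <- D) p) ^ 2)%N.
  have : {in D, forall p, M <= p ^ 2}%N.
    move=> p; rewrite mem_filter => /andP[_ /mem_window[p_pr lt _]].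
    have := prime_gt1 p_pr; nia.
  elim: D => [|p s IHs] leM; first by rewrite big_nil.
  rewrite big_cons /= expnMn expnS leq_mul ?leM ?mem_head // IHs // => q qs.
  by rewrite leM // inE qs orbT.
have le_n : (M ^ size D <= n ^ 2)%N.
  by rewrite (leq_trans le_prod) // leq_sqr dvdn_leq.
have M_gt0 : 0 < M%:R :> R by rewrite ltr0n ltnW.
have : ln ((M ^ size D)%:R : R) <= ln ((n ^ 2)%:R).
  by rewrite ler_ln ?ler_nat // posrE ltr0n expn_gt0 ?n_gt0 // ltnW.
by rewrite !natrX !lnXn ?ltr0n ?(ltnW M_ge2) // -[_ *+ size D]mulr_natl -[_ *+ 2]mulr_natl.
Qed.

(** w stands for the weight of k. [le_w] says that it dominates every common lower bound of the
    logarithms over the support, so an estimate valid for each j passes to w without choosing a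
    minimising index. *)
Variable w : R.
Hypotheses (w_ge1 : 1 <= w)
  (le_w : forall x : R, (forall j, tnth k j != 0 -> x <= ln (`|tnth k j|%:~R)) -> x <= w).

Let w_ge0 : 0 <= w. Proof. exact: le_trans ler01 w_ge1. Qed.
Let M_gt0 : 0 < M%:R :> R. Proof. by rewrite ltr0n ltnW. Qed.

(** Multiplying |D| ln M <= 2 w by the lower bound c M / ln M <= |P| cancels ln M: the proportion of
    dividing primes is at most 2 w / (c M). *)
Lemma card_dividing_M : (size D)%:R * (c * M%:R) <= 2 * w * (size P)%:R.
Proof.
have lnM : 0 < ln (M%:R : R) by rewrite ln_gt0 // ltr1n.
have leD : (size D)%:R * ln (M%:R : R) <= 2 * w.
  suff : (size D)%:R * ln (M%:R : R) / 2 <= w by lra.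
  by apply: le_w => j kj; have := size_dividing kj; lra.
have : (size D)%:R * (c * M%:R) = ((size D)%:R * ln (M%:R : R)) * (c * (M%:R / ln M%:R)).
  by field; rewrite gt_eqF.
move=> ->; apply: ler_pM => //; first by rewrite mulr_ge0 // ltW.
by rewrite mulr_ge0 ?divr_ge0 ?ltW.
Qed.

Variables (A : nat -> R[i]).

Lemma normc_window_sum (q b : nat -> R) :
  {in P, forall p, normc (A p) <= q p} ->
  {in P, forall p, ~~ dvd_coefs k p -> normc (A p) <= b p} ->
  {in P, forall p, 0 <= b p} ->
  normc (\sum_(p <- P) A p) <= \sum_(p <- P) b p + \sum_(p <- D) q p.
Proof.
move=> Aq Ab b0; apply: (le_trans (normc_sum _ _ _)).
have -> : \sum_(p <- D) q p = \sum_(p <- P) (if dvd_coefs k p then q p else 0).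
  by rewrite -big_mkcond /D big_filter.
rewrite -big_split /= big_seq [leRHS]big_seq.
apply: ler_sum => p pP; case: ifPn => dvd; last by rewrite addr0 Ab.
by apply: (le_trans (Aq _ pP)); rewrite lerDr b0.
Qed.

Let n_gt0 : 0 < (size P)%:R :> R.
Proof.
apply: lt_le_trans hcount; rewrite mulr_gt0 // divr_gt0 //.
by rewrite ln_gt0 // ltr1n.
Qed.

Lemma sum_window_ge e : (M ^ e * size P <= 2 ^ e * \sum_(p <- P) p ^ e)%N.
Proof.
rewrite big_distrr /= -sum1_size big_distrr /= big_seq [leqRHS]big_seq.
apply: leq_sum => p /mem_window[_ lt _]; rewrite muln1 -expnMn.
by case: e => [//|e]; rewrite leq_exp2r // ltnW.
Qed.

Lemma sum_window_le (Q : seq nat) e : {subset Q <= P} ->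
  (\sum_(p <- Q) p ^ e <= size Q * M ^ e)%N.
Proof.
move=> sub; rewrite -sum1_size big_distrl /= big_seq [leqRHS]big_seq.
apply: leq_sum => p /sub/mem_window[_ _ le]; rewrite mul1n.
by case: e => [//|e]; rewrite leq_exp2r.
Qed.

Let subD : {subset D <= P}. Proof. by move=> p; rewrite mem_filter => /andP[]. Qed.

(** The primes of the window lie within a factor 2 of each other, so replacing counts by sums of p^e
    costs at most 2^e. *)
Lemma dividing_sum_le e :
  (\sum_(p <- D) p ^ e)%:R * (c * M%:R) <=
  2 * w * (2 ^ e * \sum_(p <- P) p ^ e)%:R.
Proof.
apply: (@le_trans _ _ ((size D * M ^ e)%:R * (c * M%:R))).
  by rewrite ler_wpM2r ?ler_nat ?sum_window_le ?mulr_ge0 ?(ltW c_gt0).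
rewrite natrM mulrAC; apply: (@le_trans _ _ (2 * w * (size P)%:R * (M ^ e)%:R)).
  by rewrite ler_wpM2r ?card_dividing_M.
rewrite -mulrA ler_wpM2l ?mulr_ge0 // -natrM ler_nat mulnC.
exact: sum_window_ge.
Qed.

Lemma sum_window_gt0 e : 0 < (\sum_(p <- P) p ^ e)%:R :> R.
Proof.
rewrite ltr0n; have := sum_window_ge e; apply: contraTT; rewrite -leqNgt -ltnNge.
rewrite leqn0 => /eqP->; rewrite muln0 muln_gt0 expn_gt0 ltnW //=.
by move: n_gt0; rewrite ltr0n.
Qed.

(** Here |S| <= M^2 gives |S|^(1/4) <= r = sqrt M. After multiplication by c * r, the primes not
    dividing k contribute 3 and the others 4, within the constant 8. *)
Lemma window_S_bound (s : nat) : s = (\sum_(p <- P) p)%N ->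
  {in P, forall p, normc (A p) <= p%:R} ->
  {in P, forall p, ~~ dvd_coefs k p -> normc (A p) <= d%:R * Num.sqrt p%:R} ->
  (s%:R)^-1 * normc (\sum_(p <- P) A p) <= 8 * d%:R / (c * s%:R `^ (1 / 4)) * w.
Proof.
move=> sE Aq Ab; pose r := Num.sqrt (M%:R : R).
have r2 : r ^+ 2 = M%:R by rewrite sqr_sqrtr // ltW.
have r_gt0 : 0 < r by rewrite sqrtr_gt0.
have r_ge1 : 1 <= r by rewrite -[leLHS]sqrtr1 ler_sqrt // ler1n ltnW.
have s_gt0 : 0 < s%:R :> R.
  by have := sum_window_gt0 1; rewrite sE; under eq_bigr do rewrite expn1.
have d_ge1 : 1 <= d%:R :> R by rewrite ler1n.
have nM : (2 * size P <= M)%N := size_window M.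
have le_b p : p \in P -> Num.sqrt (p%:R : R) * (2 * r) <= 3 * p%:R.
  (* Squared, this is 4 * p * M <= 9 * p^2, a consequence of M < 2 * p. *)
  move=> /mem_window[p_pr lt _]; rewrite -(ler_pXn2r (n := 2)) ?nnegrE ?mulr_ge0 ?sqrtr_ge0 //.
  rewrite !exprMn sqr_sqrtr // r2.
  have : (M%:R : R) <= 2 * p%:R by rewrite -natrM ler_nat ltnW.
  have : 0 <= p%:R :> R by [].
  by nra.
have bE : (\sum_(p <- P) d%:R * Num.sqrt p%:R) * (2 * r) <= 3 * d%:R * s%:R.
  rewrite sE natr_sum mulr_suml mulr_sumr big_seq [leRHS]big_seq.
  by apply: ler_sum => p pP; rewrite -!mulrA [leRHS]mulrCA ler_wpM2l // le_b.
have DE : (\sum_(p <- D) p%:R) * (c * M%:R) <= 4 * w * s%:R.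
  have := dividing_sum_le 1; rewrite expn1 natrM.
  under [X in (X%:R * _ <= _ -> _)]eq_bigr do rewrite expn1.
  under [X in (_ <= _ * (_ * X%:R) -> _)]eq_bigr do rewrite expn1.
  by rewrite -sE -natr_sum; lra.
have le_r : s%:R `^ (1 / 4) <= r.
  have -> : r = (r ^+ 4) `^ (1 / 4).
    by rewrite -powR_mulrn ?ltW // -powRrM mul1r divff ?pnatr_eq0 // powRr1 // ltW.
  apply: ge0_ler_powR; rewrite ?nnegrE ?divr_ge0 ?exprn_ge0 ?(ltW r_gt0) //.
  have := sum_window_le 1 (fun x h => h : x \in P).
  rewrite -[4%N]/(2 * 2)%N exprM r2 sE.
  under eq_bigr do rewrite expn1.
  rewrite -natrX ler_nat => le; apply: (leq_trans le); rewrite expn1 -mulnn leq_mul2r.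
  by rewrite (leq_trans _ nM) ?orbT // leq_pmull.
have p4_gt0 : 0 < s%:R `^ (1 / 4) :> R by rewrite powR_gt0.
rewrite mulrC ler_pdivrMr //.
apply: (le_trans (normc_window_sum Aq Ab _)) => [p _|]; first by rewrite mulr_ge0 ?sqrtr_ge0.
apply: (@le_trans _ _ (8 * d%:R / (c * r) * w * s%:R)); last first.
  rewrite ler_wpM2r ?(ltW s_gt0) // ler_wpM2r // ler_wpM2l ?mulr_ge0 //.
  by rewrite lef_pV2 ?posrE ?mulr_gt0 // ler_pM2l.
have cr_gt0 : 0 < c * r by rewrite mulr_gt0.
rewrite -(ler_pM2r (x := c * r)) // mulrDl.
have -> : 8 * d%:R / (c * r) * w * s%:R * (c * r) = 8 * d%:R * w * s%:R.
  by field; rewrite !gt_eqF.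
have t1 : (\sum_(p <- P) d%:R * Num.sqrt p%:R) * (c * r) <= 3 * d%:R * w * s%:R.
  apply: le_trans (_ : 3 * d%:R * s%:R <= _); last first.
    by rewrite ler_wpM2r ?(ltW s_gt0) // ler_peMr // mulr_ge0.
  apply: le_trans bE; rewrite ler_wpM2l ?sumr_ge0 //.
  by rewrite ler_pM2r // ltW // (lt_trans c_lt1) // ltr1n.
have t2 : (\sum_(p <- D) p%:R) * (c * r) <= 4 * d%:R * w * s%:R.
  apply: le_trans (_ : 4 * w * s%:R <= _); last first.
    by rewrite ler_wpM2r ?(ltW s_gt0) // ler_wpM2r // ler_peMr.
  apply: le_trans DE; rewrite ler_wpM2l ?sumr_ge0 // ler_pM2l // -r2 expr2.
  by rewrite ler_peMr // ltW.
apply: (le_trans (lerD t1 t2)).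
have : 0 <= d%:R * w * s%:R by rewrite !mulr_ge0.
by lra.
Qed.

(** The two kinds of primes contribute 2 + 8 = 10, above 8. The excess is absorbed by |T| <= M^3 / 2
    <= (4/5 M)^3: with r = 4/5 M the constant 8 / r is 10 / M. *)
Lemma window_T_bound (s : nat) : s = (\sum_(p <- P) p ^ 2)%N ->
  {in P, forall p, normc (A p) <= (p ^ 2)%:R} ->
  {in P, forall p, ~~ dvd_coefs k p -> normc (A p) <= (d * p)%:R} ->
  (s%:R)^-1 * normc (\sum_(p <- P) A p) <= 8 * d%:R / (c * s%:R `^ (1 / 3)) * w.
Proof.
move=> sE Aq Ab.
have s_gt0 : 0 < s%:R :> R by rewrite sE sum_window_gt0.
have d_ge1 : 1 <= d%:R :> R by rewrite ler1n.
have nM : (2 * size P <= M)%N := size_window M.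
have bE : (\sum_(p <- P) (d * p)%:R) * M%:R <= 2 * d%:R * s%:R :> R.
  have -> : \sum_(p <- P) (d * p)%:R = (d * \sum_(p <- P) p)%:R :> R.
    by rewrite big_distrr natr_sum.
  rewrite sE -!natrM ler_nat -mulnA -mulnA [leqRHS]mulnCA leq_mul2l.
  apply/orP; right; rewrite big_distrl big_distrr /= big_seq [leqRHS]big_seq.
  apply: leq_sum => p /mem_window[_ lt _].
  by rewrite -mulnn mulnA [leqRHS]mulnC leq_mul2l ltnW ?orbT.
have DE : (\sum_(p <- D) (p ^ 2)%:R) * (c * M%:R) <= 8 * w * s%:R.
  by have := dividing_sum_le 2; rewrite natr_sum natrM -sE -natr_sum; lra.
pose r : R := 4 / 5 * M%:R.
have r_gt0 : 0 < r by rewrite mulr_gt0 // divr_gt0.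
have le_r : s%:R `^ (1 / 3) <= r.
  have -> : r = (r ^+ 3) `^ (1 / 3).
    by rewrite -powR_mulrn ?ltW // -powRrM mul1r divff ?pnatr_eq0 // powRr1 // ltW.
  apply: ge0_ler_powR; rewrite ?nnegrE ?divr_ge0 ?exprn_ge0 ?(ltW r_gt0) //.
  have le_s : (2 * s <= M ^ 3)%N.
    have := sum_window_le 2 (fun x h => h : x \in P); rewrite -sE => le.
    apply: (leq_trans (_ : _ <= 2 * (size P * M ^ 2))%N); first by rewrite leq_mul2l.
    by rewrite mulnA expnS leq_mul2r nM orbT.
  move: le_s; rewrite -(ler_nat R) natrM natrX exprMn => le_s.
  have : 0 <= M%:R ^+ 3 :> R by rewrite exprn_ge0 // ltW.
  by rewrite expr_div_n; lra.
have p3_gt0 : 0 < s%:R `^ (1 / 3) :> R by rewrite powR_gt0.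
rewrite mulrC ler_pdivrMr //.
apply: (le_trans (normc_window_sum Aq Ab _)) => [//|].
apply: (@le_trans _ _ (8 * d%:R / (c * r) * w * s%:R)); last first.
  rewrite ler_wpM2r ?(ltW s_gt0) // ler_wpM2r // ler_wpM2l ?mulr_ge0 //.
  by rewrite lef_pV2 ?posrE ?mulr_gt0 // ler_pM2l.
have cM_gt0 : 0 < c * M%:R by rewrite mulr_gt0.
rewrite -(ler_pM2r (x := c * M%:R)) // mulrDl.
have -> : 8 * d%:R / (c * r) * w * s%:R * (c * M%:R) = 10 * d%:R * w * s%:R.
  by rewrite /r; field; rewrite !gt_eqF.
have t1 : (\sum_(p <- P) (d * p)%:R) * (c * M%:R) <= 2 * d%:R * w * s%:R.
  apply: le_trans (_ : 2 * d%:R * s%:R <= _); last first.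
    by rewrite ler_wpM2r ?(ltW s_gt0) // ler_peMr // mulr_ge0.
  apply: le_trans bE; rewrite ler_wpM2l ?sumr_ge0 //.
  by rewrite ler_piMl ?ltW.
have t2 : (\sum_(p <- D) (p ^ 2)%:R) * (c * M%:R) <= 8 * d%:R * w * s%:R.
  apply: (le_trans DE).
  by rewrite ler_wpM2r ?(ltW s_gt0) // ler_wpM2r // ler_peMr.
apply: (le_trans (lerD t1 t2)).
have : 0 <= d%:R * w * s%:R by rewrite !mulr_ge0.
by lra.
Qed.
End Window.

(** * Absolutely convergent Fourier series *)

Section NetSums.
Local Open Scope classical_set_scope.
Variables (R : realType) (I : choiceType).
Local Notation psum := summability.partial_sum.
Local Notation totally := (@summability.totally I).
Local Notation fset := {fset I}.
Local Notation normc := (@Normc.normc R).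

#[local] Instance totally_proper : ProperFilter totally := summability.totally_filter.

Lemma psumE (V : zmodType) (u : I -> V) (J : fset) : psum u J = \sum_(i <- J) u i.
Proof. by rewrite /summability.partial_sum big_seq_fsetE. Qed.

Lemma psum_le (u : I -> R) (A B : fset) : (forall i, 0 <= u i) ->
  (A `<=` B)%fset -> psum u A <= psum u B.
Proof.
move=> u0 AB; rewrite !psumE.
rewrite [leLHS](eq_big_seq (fun i => if i \in A then u i else 0)) => [|i ->//].
rewrite (big_fset_incl _ AB) => [|i _ /negbTE->//].
by apply: ler_sum => i _; case: ifP.
Qed.

Lemma psum_cvg_ge0 (u : I -> R) K : (forall i, 0 <= u i) ->
  (forall J, psum u J <= K) -> exists l : R, psum u @ totally --> l.
Proof.
move=> u0 bnd; pose E := range (psum u).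
have supE : has_sup E.
  split; first by exists (psum u fset0); exists fset0.
  by exists K => _ [J _ <-].
exists (sup E); apply/cvgrPdist_lt => e e0.
have [_ [A _ <-] ltA] := sup_adherent e0 supE.
exists A => //= B AB.
have leB : psum u B <= sup E by apply: ub_le_sup; [case: supE | exists B].
have leAB := psum_le u0 AB.
by rewrite ger0_norm; lra.
Qed.

Lemma psum_cvg_abs (u : I -> R) K :
  (forall J, psum (fun i => `|u i|) J <= K) -> exists l : R, psum u @ totally --> l.
Proof.
move=> bnd.
have [l1 cv1] := psum_cvg_ge0 (fun i => normr_ge0 (u i)) bnd.
have [|J|l2 cv2] := @psum_cvg_ge0 (fun i => `|u i| - u i) (2 * K).
- by move=> i; rewrite subr_ge0 ler_norm.
- apply: (@le_trans _ _ (2 * psum (fun i => `|u i|) J)); last by rewrite ler_pM2l.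
  rewrite !psumE mulr_sumr; apply: ler_sum => i _.
  by have := ler_norm (- u i); rewrite normrN; lra.
exists (l1 - l2).
have -> : psum u = psum (fun i => `|u i|) - psum (fun i => `|u i| - u i).
  apply/funext => J.
  rewrite -[RHS]/(psum (fun i => `|u i|) J - psum (fun i => `|u i| - u i) J).
  by rewrite !psumE -sumrB; apply: eq_bigr => i _; rewrite subKr.
exact: cvgB cv1 cv2.
Qed.

(** [summability.sum] is a limit, whose value is known only once the partial sums converge. Bounded
    sums of norms yield this for real and imaginary parts separately. *)
Lemma psum_Re_cvg (u : I -> R[i]) K : (forall J, psum (fun i => normc (u i)) J <= K) ->
  psum (fun i => complex.Re (u i)) @ totally -->
    complex.Re (summability.sum (u : I -> (R[i])^o)).
Proof.
move=> bnd.
have bnd' (v : I -> R) : (forall i, `|v i| <= normc (u i)) ->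
    exists l : R, psum v @ totally --> l.
  move=> le_v; apply: (@psum_cvg_abs v K) => J; apply: le_trans (bnd J).
  by rewrite !psumE; apply: ler_sum.
have [a cva] := bnd' (fun i => complex.Re (u i)) (fun i => Re_le_normc (u i)).
have [|b cvb] := bnd' (fun i => complex.Im (u i)).
  move=> i; case: (u i) => x y /=.
  by rewrite -sqrtr_sqr ler_wsqrtr // lerDr sqr_ge0.
suff cvu : psum (u : I -> (R[i])^o) @ totally --> ((a +i* b)%C : (R[i])^o).
  by rewrite /summability.sum (cvg_lim _ cvu) //; exact: norm_hausdorff.
apply/cvgrPdist_lt => e e0.
have eR : e = ((complex.Re e)%:C)%C by rewrite RRe_real // gtr0_real.
have e2 : 0 < complex.Re e / 2.
  by rewrite divr_gt0 //; move: e0; rewrite ltcE /= => /andP[].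
have /cvgrPdist_lt/(_ _ e2) na := cva; have /cvgrPdist_lt/(_ _ e2) nb := cvb.
near=> J.
have ReE : complex.Re (psum u J) = psum (fun i => complex.Re (u i)) J.
  by rewrite !psumE (big_morph (@complex.Re R) (id1 := 0) (op1 := +%R)) // => -[? ?] [].
have ImE : complex.Im (psum u J) = psum (fun i => complex.Im (u i)) J.
  by rewrite !psumE (big_morph (@complex.Im R) (id1 := 0) (op1 := +%R)) // => -[? ?] [].
have ltRe : `|a - complex.Re (psum u J)| < complex.Re e / 2 by rewrite ReE; near: J.
have ltIm : `|b - complex.Im (psum u J)| < complex.Re e / 2 by rewrite ImE; near: J.
rewrite eR; move: ltRe ltIm; rewrite /=.
case: (psum u J) => x y /= ltRe ltIm.
rewrite [ltLHS]normc_norm ltcR.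
have -> : ((a +i* b) - (x +i* y) = ((a - x)%:C + 0 +i* (b - y)))%C.
  by apply/eqP; rewrite eq_complex /= add0r addr0 !eqxx.
apply: (le_lt_trans (le_normcD _ _)).
by rewrite /= !expr0n /= addr0 add0r !sqrtr_sqr; lra.
Unshelve. all: by end_near.
Qed.
End NetSums.

(** * From averages of characters to the worst-case error *)

Section WorstCase.
Local Open Scope classical_set_scope.
Variables (R : realType) (d : nat).
Local Notation vec := (d.-tuple (measurableTypeR R)).
Local Notation normc := (@Normc.normc R).
Local Notation psum := summability.partial_sum.
Implicit Types k : d.-tuple int.

(** A nonempty support keeps the minimum below +oo, so the weight is a real number. The last clause
    is the form in which the window estimates use it. *)
Lemma weight_finite k : exists w : R, [/\ weight R k = w%:E, 1 <= w &
  supp k != finset.set0 -> forall x : R,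
    (forall j, tnth k j != 0 -> x <= ln (`|tnth k j|%:~R)) -> x <= w].
Proof.
rewrite /weight; have [_|nz] := eqVneq (supp k) finset.set0.
  by exists 1; split.
set m := (\big[_/_]_(_ in _) _)%E.
have [j jk] : exists j, j \in supp k by exact/set0Pn.
have le_m (x : R) : (forall j, tnth k j != 0 -> x <= ln (`|tnth k j|%:~R)) -> (x%:E <= m)%E.
  move=> le_x; rewrite /m; apply: (big_ind (fun y => (x%:E <= y)%E)) => [|y z|i].
  - exact: leey.
  - by rewrite le_min => -> ->.
  - by rewrite inE lee_fin; exact: le_x.
have m_le : (m <= (ln (`|tnth k j|%:~R))%:E)%E.
  by rewrite /m (bigD1 j) //= ge_min lexx.
have m_ge0 : (0 <= m)%E.
  apply: (le_m 0) => i ki; rewrite ln_ge0 // -[1]/(1%:~R) ler_int.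
  by rewrite -gtz0_ge1 normr_gt0.
have m_fin : m \is a fin_num by rewrite ge0_fin_numE // (le_lt_trans m_le) // ltry.
exists (Num.max 1 (fine m)); split => [||_ x le_x].
- by rewrite EFin_max fineK.
- by rewrite le_max lexx.
- by rewrite le_max; apply/orP; right; rewrite -lee_fin fineK // le_m.
Qed.

Lemma cvg_big_seq (T U : Type) (F : set_system T) (FF : Filter F) (s : seq U)
    (f : U -> T -> R) (l : U -> R) :
  (forall x, f x @ F --> l x) ->
  (fun t => \sum_(x <- s) f x t) @ F --> \sum_(x <- s) l x.
Proof.
move=> cv; elim: s => [|x s IHs].
  rewrite big_nil; under eq_fun do rewrite big_nil; exact: cvg_cst.
rewrite big_cons; under eq_fun do rewrite big_cons; exact: cvgD.
Qed.

Variables (Pts : seq vec) (B : R).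
Hypotheses (Pts_gt0 : (0 < size Pts)%N) (B_ge0 : 0 <= B).

Definition avg k : R[i] := (size Pts)%:R^-1 * \sum_(x <- Pts) expi2pi (dot k x).

Hypothesis avg_le : forall k (w : R), supp k != finset.set0 -> weight R k = w%:E ->
  normc (avg k) <= B * w.

Lemma supp_eq0 k : supp k = finset.set0 -> k = [tuple 0 | _ < d].
Proof.
move=> k0; apply: eq_from_tnth => j; rewrite tnth_mktuple.
have : j \notin supp k by rewrite k0 inE.
by rewrite inE negbK => /eqP.
Qed.

Lemma dot0 (x : vec) : dot [tuple 0 | _ < d] x = 0.
Proof. by rewrite /dot big1 // => j _; rewrite tnth_mktuple mul0r. Qed.

(** The integral enters as the zeroth coefficient of f itself, so it cancels against the zero
    frequency of the Fourier sum without integrating the series. *)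
Lemma cube_integralE (f : vec -> R) :
  complex.Re (fourier_coef f [tuple 0 | _ < d]) = cube_integral f.
Proof.
rewrite /fourier_coef /cube_cintegral /=; congr (cube_integral _).
apply/funext => x; rewrite dot0 oppr0.
by rewrite !mulr0 cos0 mul0r subr0 mulr1.
Qed.

Lemma psum_fourier_le (f : vec -> R) (J : {fset d.-tuple int}) :
  (normF f <= 1)%E ->
  \sum_(k <- J) normc (fourier_coef f k) * fine (weight R k) <= 1.
Proof.
move=> f1; rewrite -lee_fin; apply: le_trans f1; apply: esum_ge.
exists [set` J]; first by split.
rewrite -fsbig_seq ?fset_uniq // -sumEFin; apply: lee_sum => k _.
by have [w [-> _ _]] := weight_finite k; rewrite EFinM.
Qed.

Lemma worst_case_error_le : (worst_case_error (qmc Pts) <= B%:E)%E.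
Proof.
apply: ge_ereal_sup => _ [f [_ f1] <-]; rewrite lee_fin.
pose a := fourier_coef f; pose k0 : d.-tuple int := [tuple 0 | _ < d].
pose u (x : vec) k : R[i] := a k * expi2pi (dot k x).
have wt_ge1 k : 1 <= fine (weight R k).
  by have [w [-> ? _]] := weight_finite k.
have cvx x : psum (fun k => complex.Re (u x k)) @ summability.totally --> fourier_sum f x.
  apply: (@psum_Re_cvg _ _ (u x) 1) => J; apply: le_trans (psum_fourier_le J f1).
  rewrite psumE; apply: ler_sum => k _.
  by rewrite Normc.normcM normc_expi2pi mulr1 ler_peMr ?normc_ge0.
pose Q J := (size Pts)%:R^-1 * \sum_(x <- Pts) psum (fun k => complex.Re (u x k)) J.
have FF := summability.totally_filter (I := d.-tuple int).
have cvQ : Q @ summability.totally --> qmc Pts (fourier_sum f).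
  by apply: cvgMr; exact: cvg_big_seq.
have QE J : Q J = complex.Re (\sum_(k <- J) a k * avg k).
  have ReS (I : Type) (s : seq I) (F : I -> R[i]) :
      complex.Re (\sum_(i <- s) F i) = \sum_(i <- s) complex.Re (F i).
    by apply: (big_morph (@complex.Re R) (id1 := 0) (op1 := +%R)) => // -[? ?] [].
  have ReM (r : R) (z : R[i]) : complex.Re (r%:C%C * z) = r * complex.Re z.
    by case: z => x y /=; rewrite mul0r subr0.
  rewrite /Q; under eq_bigr do rewrite psumE -ReS.
  rewrite -ReS -ReM exchange_big /= fmorphV rmorph_nat mulr_sumr; congr complex.Re.
  apply: eq_bigr => k _; rewrite /avg /u -mulr_sumr; ring.
have cvI : (fun J => `|cube_integral f - Q J|) @ summability.totally -->
    `|cube_integral f - qmc Pts (fourier_sum f)|.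
  by apply: cvg_norm; apply: cvgB => //; exact: cvg_cst.
(* The bound holds for every finite J containing the zero frequency and passes to the limit. *)
apply: (cvgr_to_le cvI); exists [fset k0]%fset => //= J kJ.
have k0J : k0 \in J by apply: (fsubsetP kJ); rewrite inE.
have avg0 : avg k0 = 1.
  rewrite /avg (eq_bigr (fun _ => 1)) => [|x _]; last by rewrite dot0 expi2pi0.
  by rewrite big_const_seq count_predT iter_addr addr0 mulVf // pnatr_eq0 -lt0n.
rewrite QE (big_fsetD1 k0) //= avg0 mulr1.
rewrite (_ : complex.Re (_ + _) = cube_integral f + complex.Re
    (\sum_(k <- (J `\ k0)%fset) a k * avg k)); last first.
  by rewrite -cube_integralE -/k0 -/(a k0); case: (a k0) (\sum_(k <- _) _) => ? ? [].
rewrite opprD addNKr normrN; apply: (le_trans (Re_le_normc _)).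
apply: (le_trans (normc_sum _ _ _)).
(* The zero frequency is put back, with a nonnegative term, so that the whole sum is at most
   [normF f]. *)
apply: (@le_trans _ _ (B * \sum_(k <- J) normc (a k) * fine (weight R k))); last first.
  by rewrite ler_piMr // psum_fourier_le.
rewrite [X in B * X](big_fsetD1 k0) //= mulrDr mulr_sumr.
apply: (@le_trans _ _ (\sum_(k <- (J `\ k0)%fset) B * (normc (a k) * fine (weight R k)))).
  rewrite big_seq [leRHS]big_seq; apply: ler_sum => k.
  rewrite !inE => /andP[k_neq _]; rewrite Normc.normcM mulrCA ler_wpM2l ?normc_ge0 //.
  have [w [wE _ _]] := weight_finite k.
  rewrite wE /=; apply: avg_le => //.
  by apply: contra_neq k_neq; exact: supp_eq0.
by rewrite lerDr !mulr_ge0 ?normc_ge0 // (le_trans ler01).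
Qed.
End WorstCase.

Lemma qmc_error_le (R : realType) (d M : nat) (Pts : seq (d.-tuple (measurableTypeR R)))
    (A : d.-tuple int -> nat -> R[i]) (B : R) :
  (0 < size Pts)%N -> 0 <= B ->
  (forall k, \sum_(x <- Pts) expi2pi (dot k x) = \sum_(p <- prime_window M) A k p) ->
  (forall (k : d.-tuple int) (w : R), 1 <= w ->
    (forall x : R, (forall j, tnth k j != 0 -> x <= ln (`|tnth k j|%:~R)) -> x <= w) ->
    (size Pts)%:R^-1 * Normc.normc (\sum_(p <- prime_window M) A k p) <= B * w) ->
  (worst_case_error (qmc Pts) <= B%:E)%E.
Proof.
move=> sz B0 AE bnd; apply: worst_case_error_le => // k w k0 wE.
have [w' [w'E w'1 /(_ k0) le_w']] := weight_finite R k.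
have {w'E} ww' : w = w' by move: w'E; rewrite wE => -[].
rewrite /avg Normc.normcM Normc.normcV normc_natr AE.
by apply: bnd; rewrite ww'.
Qed.

Theorem theorem2p5 (R : realType) (c C : R)
    (hc : 0 < c < 1) (hC : 1 < C)
    (hcount : forall N : nat, (2 <= N)%N ->
       c * (N%:R / ln N%:R) <= (size (prime_window N))%:R <=
       C * (N%:R / ln N%:R))
    (d M : nat) (hd : (0 < d)%N) (hM : (2 <= M)%N) :
  [/\ (worst_case_error (qmc (S_comp R M d)) <=
        (8 * d%:R / (c * (size (S_comp R M d))%:R `^ (1 / 4)))%:E)%E,
      (worst_case_error (qmc (T_comp R M d)) <=
        (8 * d%:R / (c * (size (T_comp R M d))%:R `^ (1 / 3)))%:E)%E &
      (worst_case_error (qmc (U_comp R M d)) <=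
        (8 * d%:R / (c * (size (U_comp R M d))%:R `^ (1 / 3)))%:E)%E].
Proof.
have /andP[c0 c1] := hc; have /andP[hcM _] := hcount M hM.
have B0 (n : nat) (e : R) : 0 <= 8 * d%:R / (c * n%:R `^ e).
  by rewrite divr_ge0 ?mulr_ge0 ?powR_ge0 // ltW.
have pr p : p \in prime_window M -> prime p by case/mem_window.
have sz e : (0 < \sum_(p <- prime_window M) p ^ e)%N.
  by rewrite -(ltr0n R) (sum_window_gt0 c0 hM hcM).
have trivial2 q p (F : nat -> nat -> int) :
    Normc.normc (\sum_(0 <= a < p) \sum_(0 <= n < p) ep R q (F a n)) <= (p ^ 2)%:R.
  apply: (le_trans (normc_sum _ _ _)).
  apply: (@le_trans _ _ (\sum_(0 <= a < p) p%:R)).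
    by apply: ler_sum => a _; exact: normc_sum_ep.
  by rewrite big_const_nat subn0 iter_addr addr0 -mulrnA mulnn.
split.
- apply: (qmc_error_le (M := M) (A := fun k p =>
    \sum_(0 <= n < p) ep R p (phase k).[n%:Z])) => [||k|k w w1 le_w].
  + by have := sz 1%N; rewrite size_S_comp; under eq_bigr do rewrite expn1.
  + exact: B0.
  + rewrite big_allpairs_dep; apply: eq_bigr => p _; rewrite /index_iota subn0.
    by apply: eq_bigr => n _; rewrite expi2pi_dot_korobov mul1r.
  + apply: (window_S_bound c0 c1 hM hcM hd w1 le_w (size_S_comp R M d)) => p /pr p_pr.
      exact: normc_sum_ep.
    exact: korobov_S_bound.
- apply: (qmc_error_le (M := M) (A := fun k p =>
    \sum_(0 <= n < p ^ 2) ep R (p ^ 2) (phase k).[n%:Z])) => [||k|k w w1 le_w].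
  + by rewrite size_T_comp.
  + exact: B0.
  + rewrite big_allpairs_dep; apply: eq_bigr => p _; rewrite /index_iota subn0.
    by apply: eq_bigr => n _; rewrite expi2pi_dot_korobov mul1r.
  + apply: (window_T_bound c0 c1 hM hcM hd w1 le_w (size_T_comp R M d)) => p /pr p_pr.
      exact: normc_sum_ep.
    exact: korobov_T_bound.
- apply: (qmc_error_le (M := M) (A := fun k p =>
    \sum_(0 <= a < p) \sum_(0 <= n < p) ep R p (a%:Z * (phase k).[n%:Z])))
    => [||k|k w w1 le_w].
  + by rewrite size_U_comp.
  + exact: B0.
  + rewrite big_flatten big_map; apply: eq_bigr => p _.
    rewrite big_allpairs_dep /index_iota subn0; apply: eq_bigr => a _.
    by apply: eq_bigr => n _; rewrite expi2pi_dot_korobov.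
  + apply: (window_T_bound c0 c1 hM hcM hd w1 le_w (size_U_comp R M d)) => p /pr p_pr.
      exact: trivial2.
    exact: korobov_U_bound.
Qed.
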